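(* Let $\mathcal{N}\to\mathcal{E}\xrightarrow{j}\mathcal{G}$ be a groupoid extension, let $k:\mathcal{G}\to\mathcal{E}$ be a normalized section for $j$, let $(L,\sigma)$ be the associated factor system for $(\mathcal{G},\mathcal{N})$, and let $(M,\tau)$ be the associated factor system for $(\mathcal{G},\mathbb{C}[\mathcal{N}])$. Then the map $$\Phi:\mathbb{C}[\mathcal{E}]\to\mathbb{C}[\mathcal{N}]\times_{(M,\tau)}\mathcal{G},\qquad \Phi(f)(x)(n):=f(nk(x)),\quad x\in\mathcal{G},\ n\in N_{r(x)},$$ is an isometric $*$-homomorphism, and therefore the $C^*$-algebras $C^*(\mathcal{E})$ and $C^*(\mathcal{G},\mathbb{C}[\mathcal{N}],M,\tau)$ are isomorphic.
   Context: Groupoids are purely algebraic (no topology). A groupoid $\mathcal{G}$ has unit space $\mathcal{G}^{(0)}\subseteq\mathcal{G}$ and range and source maps $r,s$; $xy$ is defined iff $s(x)=r(y)$; $\mathcal{G}^{(2)}$ is the set of composable pairs. A group bundle over $\mathcal{G}^{(0)}$ is a set $\mathcal{N}$ with a map $p:\mathcal{N}\to\mathcal{G}^{(0)}$ whose fibres $N_u$ are groups; it is a groupoid over $\mathcal{G}^{(0)}$ (identify the identity of $N_u$ with $u$; $r=s=p$). Extension. A groupoid extension $\mathcal{N}\to\mathcal{E}\xrightarrow{j}\mathcal{G}$ is a surjective groupoid homomorphism $j:\mathcal{E}\to\mathcal{G}$, where $\mathcal{E}$ is a groupoid with unit space $\mathcal{G}^{(0)}$, $j$ is the identity on $\mathcal{G}^{(0)}$,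 and $\mathcal{N}=\{e\in\mathcal{E}: j(e)\in\mathcal{G}^{(0)}\}$. A normalized section is a map $k:\mathcal{G}\to\mathcal{E}$ with $j\circ k=\mathrm{id}_{\mathcal{G}}$ and $k|_{\mathcal{G}^{(0)}}=\mathrm{id}$. Its associated factor system $(L,\sigma)$ consists of the group isomorphisms $L_x:N_{s(x)}\to N_{r(x)}$, $L_x(n)=k(x)nk(x)^{-1}$, and the map $\sigma:\mathcal{G}^{(2)}\to\mathcal{N}$, $\sigma(x,y)\in N_{r(x)}$, determined by $k(x)k(y)=\sigma(x,y)k(xy)$. Algebras. $\mathbb{C}[\mathcal{E}]$ is the $*$-algebra of finitely supported functions $f:\mathcal{E}\to\mathbb{C}$ with product $(fg)(z)=\sum_{xy=z}f(x)g(y)$, involution $f^*(e)=\overline{f(e^{-1})}$ and norm $\|f\|_1=\sum_{e\in\mathcal{E}}|f(e)|$. $\mathbb{C}[\mathcal{N}]$ denotes the bundle over $\mathcal{G}^{(0)}$ whose fibre at $u$ is the group algebra $\mathbb{C}[N_u]$ with convolution, involution $f^*(n)=\overline{f(n^{-1})}$ and norm $\|f\|=\sum_{n\in N_u}|f(n)|$. The associated factor system is $M_x:\mathbb{C}[N_{s(x)}]\to\mathbb{C}[N_{r(x)}]$, $M_x(f)=f\circ L_x^{-1}$, and $\tau(x,y)=\delta_{\sigma(x,y)}\in\mathbb{C}[N_{r(x)}]$ (the characteristic function of $\{\sigma(x,y)\}$). $\mathbb{C}[\mathcal{N}]\times_{(M,\tau)}\mathcal{G}$ is the normed $*$-algebra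 of finitely supported functions $f$ on $\mathcal{G}$ with $f(x)\in\mathbb{C}[N_{r(x)}]$, with product $(fg)(z)=\sum_{xy=z}f(x)M_x(g(y))\tau(x,y)$, norm $\|f\|_1=\sum_{x\in\mathcal{G}}\|f(x)\|$ and involution $f^*(x)=\tau(x,x^{-1})^{-1}M_x(f(x^{-1}))^*$. $C^*$-algebras. $C^*(\mathcal{G},\mathbb{C}[\mathcal{N}],M,\tau)$ is the universal enveloping $C^*$-algebra of the normed $*$-algebra $(\mathbb{C}[\mathcal{N}]\times_{(M,\tau)}\mathcal{G},\|\cdot\|_1,{}^* )$, and $C^*(\mathcal{E})$ is the universal enveloping $C^*$-algebra of $(\mathbb{C}[\mathcal{E}],\|\cdot\|_1,{}^* )$. *)

(* Defs.v *)
From HB Require Import structures.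
From mathcomp Require Import all_boot all_order all_algebra complex finmap.
From mathcomp Require Import all_classical all_reals all_analysis.

Set Implicit Arguments.
Unset Strict Implicit.
Unset Printing Implicit Defensive.

Import Order.TTheory GRing.Theory Num.Theory.
Import numFieldNormedType.Exports.

Local Open Scope classical_set_scope.
Local Open Scope complex_scope.
Local Open Scope ring_scope.

Lemma fsbig_neq0 (V : nmodType) (I : choiceType) (A : set I) (F : I -> V) :
  \sum_(i \in A) F i != 0 -> exists2 i, A i & F i != 0.
Proof.
move=> s0; apply: contrapT => h; move/negP: s0; apply; apply/eqP.
apply: fsbig1 => i Ai; apply: contrapT => Fi0; apply: h.
by exists i => //; apply/eqP.
Qed.

(* Finitely supported families in [forall i, V i] with the l^1 norm
   [\sum_i `|f i|]. *)
Record fsprod (K : numFieldType) (I : choiceType) (V : I -> normedModType K) :=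
  FsProd { fsprod_fun :> forall i, V i;
           fsprod_fin : finite_set [set i | fsprod_fun i != 0] }.
Arguments FsProd {K I V}.

Section FsProdModule.
Context {K : numFieldType} {I : choiceType} {V : I -> normedModType K}.
Implicit Types f g h : fsprod V.

Lemma fsprodP f g : (forall i, f i = g i) -> f = g.
Proof.
case: f g => [f ff] [g fg] /= fg0.
have e : f = g by apply: functional_extensionality_dep.
by subst g; congr FsProd; exact: Prop_irrelevance.
Qed.

HB.instance Definition _ := gen_eqMixin (fsprod V).
HB.instance Definition _ := gen_choiceMixin (fsprod V).

Fact fsprod0_fin : finite_set [set i | (0 : V i) != 0].
Proof.
by rewrite [X in finite_set X](_ : _ = set0)// -subset0 => i /=; rewrite eqxx.
Qed.

Fact fsprodN_fin f : finite_set [set i | - f i != 0].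
Proof.
by apply: sub_finite_set (fsprod_fin f) => i /=; rewrite oppr_eq0.
Qed.

Fact fsprodD_fin f g : finite_set [set i | f i + g i != 0].
Proof.
have fU : finite_set ([set i | f i != 0] `|` [set i | g i != 0]).
  by rewrite finite_setU; split; exact: fsprod_fin.
apply: sub_finite_set fU => i /=.
by have [->|fi0 _] := eqVneq (f i) 0; [rewrite add0r; right|left].
Qed.

Fact fsprodZ_fin (t : K) f : finite_set [set i | t *: f i != 0].
Proof.
by apply: sub_finite_set (fsprod_fin f) => i /=; rewrite scaler_eq0 => /norP[].
Qed.

Let zero : fsprod V := FsProd (fun i => 0) fsprod0_fin.
Let opp f := FsProd (fun i => - f i) (fsprodN_fin f).
Let add f g := FsProd (fun i => f i + g i) (fsprodD_fin f g).
Let scale (t : K) f := FsProd (fun i => t *: f i) (fsprodZ_fin t f).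

Fact fsprod_addA : associative add.
Proof. by move=> f g h; apply: fsprodP => i /=; rewrite addrA. Qed.
Fact fsprod_addC : commutative add.
Proof. by move=> f g; apply: fsprodP => i /=; rewrite addrC. Qed.
Fact fsprod_add0 : left_id zero add.
Proof. by move=> f; apply: fsprodP => i /=; rewrite add0r. Qed.
Fact fsprod_addN : left_inverse zero opp add.
Proof. by move=> f; apply: fsprodP => i /=; rewrite addNr. Qed.

HB.instance Definition _ := GRing.isZmodule.Build (fsprod V)
  fsprod_addA fsprod_addC fsprod_add0 fsprod_addN.

Fact fsprod_scaleA (a b : K) f : scale a (scale b f) = scale (a * b) f.
Proof. by apply: fsprodP => i /=; rewrite scalerA. Qed.
Fact fsprod_scale1 : left_id 1 scale.
Proof. by move=> f; apply: fsprodP => i /=; rewrite scale1r. Qed.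
Fact fsprod_scaleDr : right_distributive scale +%R.
Proof. by move=> a f g; apply: fsprodP => i /=; rewrite scalerDr. Qed.
Fact fsprod_scaleDl f : {morph scale^~ f : a b / a + b}.
Proof. by move=> a b; apply: fsprodP => i /=; rewrite scalerDl. Qed.

HB.instance Definition _ := GRing.Zmodule_isLmodule.Build K (fsprod V)
  fsprod_scaleA fsprod_scale1 fsprod_scaleDr fsprod_scaleDl.

Lemma fsprodD f g i : (f + g) i = f i + g i. Proof. by []. Qed.
Lemma fsprodN f i : (- f) i = - f i. Proof. by []. Qed.
Lemma fsprodZ (t : K) f i : (t *: f) i = t *: f i. Proof. by []. Qed.
Lemma fsprod0 i : (0 : fsprod V) i = 0. Proof. by []. Qed.

Let norm f : K := \sum_(i \in [set: I]) `|f i|.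

Lemma fsprod_normE f (A : set I) : finite_set A ->
  (forall i, f i != 0 -> A i) -> norm f = \sum_(i <- fset_set A) `|f i|.
Proof.
move=> finA fA; rewrite /norm -fsbig_finite//; apply/esym/fsbig_widen => //.
move=> i [_ /= nA]; apply/normr0P; apply/negPn/negP => /fA; exact: nA.
Qed.

Fact fsprod_ler_normD f g : norm (f + g) <= norm f + norm g.
Proof.
pose A := [set i | f i != 0] `|` [set i | g i != 0].
have finA : finite_set A by rewrite finite_setU; split; exact: fsprod_fin.
have fA i : f i != 0 -> A i by left.
have gA i : g i != 0 -> A i by right.
have fgA i : (f + g) i != 0 -> A i.
  by rewrite fsprodD; have [->|fi0 _] := eqVneq (f i) 0;
    [rewrite add0r; right|left].
rewrite !(fsprod_normE finA)// -big_split/=.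
by apply: ler_sum => i _; exact: ler_normD.
Qed.

Fact fsprod_normrZ (t : K) f : norm (t *: f) = `|t| * norm f.
Proof.
have tfA i : (t *: f) i != 0 -> [set i | f i != 0] i.
  by rewrite fsprodZ scaler_eq0 => /norP[].
rewrite !(fsprod_normE (fsprod_fin f))// mulr_sumr.
by apply: eq_bigr => i _; rewrite fsprodZ normrZ.
Qed.

Fact fsprod_normr0_eq0 f : norm f = 0 -> f = 0.
Proof.
rewrite (fsprod_normE (fsprod_fin f))// => /eqP.
rewrite psumr_eq0// => /allP f0; apply: fsprodP => i.
have [//|fi0] := eqVneq (f i) 0.
have /f0/= : i \in fset_set [set i | f i != 0].
  by rewrite in_fset_set; [rewrite inE|exact: fsprod_fin].
by rewrite normr_eq0 => /eqP.
Qed.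

HB.instance Definition _ := Lmodule_isNormed.Build K (fsprod V)
  fsprod_ler_normD fsprod_normrZ fsprod_normr0_eq0.

Lemma fsprod_norm f : `|f| = \sum_(i \in [set: I]) `|f i|. Proof. by []. Qed.

End FsProdModule.

(* A groupoid with unit space [U]. The unit space is a separate type, embedded by
   [gid], so that groupoids with the same unit space share it literally.
   [gmul x y] is meaningful only for composable pairs, [src x = rng y]; no axiom
   restricts its value on the other pairs. *)
HB.mixin Record isGroupoid (U : choiceType) (G : Type) := {
  rng : G -> U;
  src : G -> U;
  gid : U -> G;
  gmul : G -> G -> G;
  ginv : G -> G;
  rng_gid : forall u, rng (gid u) = u;
  src_gid : forall u, src (gid u) = u;
  rng_gmul : forall x y, src x = rng y -> rng (gmul x y) = rng x;
  src_gmul : forall x y, src x = rng y -> src (gmul x y) = src y;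
  gmulA : forall x y z, src x = rng y -> src y = rng z ->
    gmul x (gmul y z) = gmul (gmul x y) z;
  gmul1l : forall x, gmul (gid (rng x)) x = x;
  gmul1r : forall x, gmul x (gid (src x)) = x;
  rng_ginv : forall x, rng (ginv x) = src x;
  src_ginv : forall x, src (ginv x) = rng x;
  gmulV : forall x, gmul x (ginv x) = gid (rng x);
  gmulVl : forall x, gmul (ginv x) x = gid (src x)
}.

#[short(type="groupoidType")]
HB.structure Definition Groupoid (U : choiceType) :=
  {G of Choice G & isGroupoid U G}.

Section GroupoidTheory.
Context {U : choiceType} {G : groupoidType U}.
Implicit Types x y z : G.

Lemma gmulKl x y : src x = rng y -> gmul (ginv x) (gmul x y) = y.
Proof.
by move=> xy; rewrite gmulA ?src_ginv// gmulVl xy gmul1l.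
Qed.

Lemma gmulKr x y : src x = rng y -> gmul (gmul x y) (ginv y) = x.
Proof.
by move=> xy; rewrite -gmulA ?rng_ginv// gmulV -xy gmul1r.
Qed.

Lemma ginvK x : ginv (ginv x) = x.
Proof.
have := gmulKl (src_ginv x).
by rewrite gmulVl -rng_ginv -src_ginv gmul1r.
Qed.

Lemma gmul_eq1 x y : src x = rng y -> gmul x y = gid (rng x) -> y = ginv x.
Proof.
by move=> xy xy1; rewrite -(gmulKl xy) xy1 -src_ginv gmul1r.
Qed.

End GroupoidTheory.

HB.mixin Record hasProdStar (A : Type) := {
  amul : A -> A -> A;
  astar : A -> A
}.

(* The data from which an enveloping C*-algebra is formed: a complex normed space
   with a product [a ** b] and an involution [astar a]. The laws of a *-algebra
   are not part of this structure, since the definition of [envelope] does not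
   use them; [isCStarAlgebra] has them for C*-algebras. *)
#[short(type="normedStarType")]
HB.structure Definition NormedStar (R : realType) :=
  {A of NormedModule R[i] A & hasProdStar A}.

Notation "a ** b" := (amul a b) (at level 40, left associativity) : ring_scope.

HB.mixin Record isCStarAlgebra (R : realType) A
    of NormedStar R A & CompleteNormedModule R[i] A := {
  amulA : forall a b c : A, a ** (b ** c) = a ** b ** c;
  amulDl : forall a b c : A, (a + b) ** c = a ** c + b ** c;
  amulDr : forall a b c : A, a ** (b + c) = a ** b + a ** c;
  amulZl : forall (t : R[i]) (a b : A), (t *: a) ** b = t *: (a ** b);
  amulZr : forall (t : R[i]) (a b : A), a ** (t *: b) = t *: (a ** b);
  astarK : forall a : A, astar (astar a) = a;
  astarD : forall a b : A, astar (a + b) = astar a + astar b;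
  astarZ : forall (t : R[i]) (a : A), astar (t *: a) = t^* *: astar a;
  astarM : forall a b : A, astar (a ** b) = astar b ** astar a;
  normr_amul : forall a b : A, `|a ** b| <= `|a| * `|b|;
  normr_cstar : forall a : A, `|astar a ** a| = `|a| ^+ 2
}.

#[short(type="cstarAlgType")]
HB.structure Definition CStarAlgebra (R : realType) :=
  {A of NormedStar R A & CompleteNormedModule R[i] A & isCStarAlgebra R A}.

Record is_star_hom (R : realType) (A B : normedStarType R) (phi : A -> B) :
    Prop := IsStarHom {
  star_homD : {morph phi : a b / a + b};
  star_homZ : forall (t : R[i]) (a : A), phi (t *: a) = t *: phi a;
  star_homM : {morph phi : a b / a ** b};
  star_homS : {morph phi : a / astar a}
}.

Section GroupAlgebra.
Context (R : realType) (H : groupType).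

Definition group_algebra : Type := fsprod (fun _ : H => (R[i])^o).
HB.instance Definition _ := NormedModule.on group_algebra.
Implicit Types f g : group_algebra.

Fact ga_mul_fin f g : finite_set
  [set n | \sum_(p \in [set p : H * H | (p.1 * p.2)%g = n]) f p.1 * g p.2 != 0].
Proof.
have fin := finite_setX (fsprod_fin f) (fsprod_fin g).
apply: sub_finite_set (finite_image (fun p => (p.1 * p.2)%g) fin).
move=> n /= /fsbig_neq0[[a b]/= abn ab0]; exists (a, b) => //=.
by split; apply: contraNN ab0 => /eqP ->; rewrite ?mul0r ?mulr0.
Qed.

Fact ga_star_fin f : finite_set [set n : H | ((f n^-1%g : R[i])^*) != 0].
Proof.
apply: sub_finite_set (finite_image (fun n : H => (n^-1)%g) (fsprod_fin f)).
move=> n /= fn; exists n^-1%g; rewrite ?invgK//.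
by apply: contraNN fn => /eqP ->; rewrite rmorph0.
Qed.

HB.instance Definition _ := hasProdStar.Build group_algebra
  (fun f g => FsProd _ (ga_mul_fin f g)) (fun f => FsProd _ (ga_star_fin f)).

Fact ga_delta_fin (m : H) : finite_set [set n : H | ((n == m)%:R : R[i]^o) != 0].
Proof.
apply: sub_finite_set (finite_set1 m) => n /=.
by case: (n =P m) => //; rewrite eqxx.
Qed.

Definition delta (m : H) : group_algebra := FsProd _ (ga_delta_fin m).

Lemma delta_mul (m n : H) : delta m ** delta n = delta (m * n)%g.
Proof.
have d (q : H * H) : q <> (m, n) -> delta m q.1 * delta n q.2 = 0 :> R[i].
  case: q => a b /= h; have [am|] := eqVneq a m; last by rewrite mul0r.
  have [bn|] := eqVneq b n; last by rewrite mulr0.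
  by case: h; rewrite am bn.
apply: fsprodP => l /=; have [lmn|ne] := eqVneq l (m * n)%g; last first.
  by apply: fsbig1 => q /= ql; apply: d => qmn; rewrite -ql qmn eqxx in ne.
have S : [set (m, n)] `<=` [set p : H * H | (p.1 * p.2)%g = l].
  by move=> _ /= ->.
rewrite -(@fsbig_widen _ _ _ _ _ _ _ S); last by move=> q [_ /= nq]; exact: d.
by rewrite fsbig_set1 /= !eqxx mulr1.
Qed.

End GroupAlgebra.

Section GroupoidAlgebra.
Context (R : realType) (U : choiceType) (E : groupoidType U).

Definition groupoid_algebra : Type := fsprod (fun _ : E => (R[i])^o).
HB.instance Definition _ := NormedModule.on groupoid_algebra.
Implicit Types f g : groupoid_algebra.

Fact gpda_mul_fin f g : finite_set [set z |
  \sum_(p \in [set p : E * E | src p.1 = rng p.2 /\ gmul p.1 p.2 = z])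
    f p.1 * g p.2 != 0].
Proof.
have fin := finite_setX (fsprod_fin f) (fsprod_fin g).
apply: sub_finite_set (finite_image (fun p => gmul p.1 p.2) fin).
move=> n /= /fsbig_neq0[[a b]/= [_ abn] ab0]; exists (a, b) => //=.
by split; apply: contraNN ab0 => /eqP ->; rewrite ?mul0r ?mulr0.
Qed.

Fact gpda_star_fin f : finite_set [set e : E | ((f (ginv e) : R[i])^*) != 0].
Proof.
apply: sub_finite_set (finite_image (fun e : E => ginv e) (fsprod_fin f)).
move=> n /= fn; exists (ginv n); rewrite ?ginvK//.
by apply: contraNN fn => /eqP ->; rewrite rmorph0.
Qed.

HB.instance Definition _ := hasProdStar.Build groupoid_algebra
  (fun f g => FsProd _ (gpda_mul_fin f g)) (fun f => FsProd _ (gpda_star_fin f)).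

End GroupoidAlgebra.

(* [j : E -> G] is onto and the identity on the common unit space [U]. *)
Record extension (U : choiceType) (E G : groupoidType U) := Extension {
  ext_fun :> E -> G;
  ext_rng : forall e, rng (ext_fun e) = rng e;
  ext_src : forall e, src (ext_fun e) = src e;
  ext_gid : forall u, ext_fun (gid u) = gid u;
  ext_gmul : forall a b, src a = rng b ->
    ext_fun (gmul a b) = gmul (ext_fun a) (ext_fun b);
  ext_surj : forall x, exists e, ext_fun e = x
}.

Record normalized_section (U : choiceType) (E G : groupoidType U)
    (j : extension E G) := NormalizedSection {
  sec_fun :> G -> E;
  sec_cancel : cancel sec_fun j;
  sec_gid : forall u, sec_fun (gid u) = gid u
}.

(* [N_u], the fibre over [u] of the bundle [{n | j n is a unit}]; elements of it
   have range and source [u] by [rng_fibre] and [src_fibre]. *)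
Definition fibre (U : choiceType) (E G : groupoidType U) (j : extension E G)
  (u : U) : Type := {n : E | j n == gid u}.

Section Fibre.
Context {U : choiceType} {E G : groupoidType U} {j : extension E G}.
Implicit Types u v : U.

HB.instance Definition _ u := Choice.on (fibre j u).

Lemma fibreP u (n : fibre j u) : j (val n) = gid u.
Proof. exact/eqP/(valP n). Qed.
Lemma rng_fibre u (n : fibre j u) : rng (val n) = u.
Proof. by rewrite -(ext_rng j) fibreP rng_gid. Qed.
Lemma src_fibre u (n : fibre j u) : src (val n) = u.
Proof. by rewrite -(ext_src j) fibreP src_gid. Qed.

Lemma ext_ginv (e : E) : j (ginv e) = ginv (j e).
Proof.
apply: gmul_eq1; first by rewrite ext_src ext_rng rng_ginv.
by rewrite -ext_gmul ?rng_ginv// gmulV ext_gid ext_rng.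
Qed.

Fact fibre1_subproof u : j (gid u) == gid u.
Proof. by rewrite ext_gid. Qed.
Fact fibreM_subproof u (m n : fibre j u) : j (gmul (val m) (val n)) == gid u.
Proof.
rewrite ext_gmul ?src_fibre ?rng_fibre// !fibreP.
by have := gmul1l (gid u : G); rewrite rng_gid => ->.
Qed.
Fact fibreV_subproof u (n : fibre j u) : j (ginv (val n)) == gid u.
Proof.
rewrite ext_ginv fibreP -(gmul1l (ginv _)) rng_ginv src_gid.
by rewrite gmulV rng_gid.
Qed.

Let fone u : fibre j u := exist _ (gid u) (fibre1_subproof u).
Let fmul u (m n : fibre j u) : fibre j u := 
  exist _ (gmul (val m) (val n)) (fibreM_subproof m n).
Let finv u (n : fibre j u) : fibre j u := 
  exist _ (ginv (val n)) (fibreV_subproof n).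

Fact fibre_mulA u : associative (@fmul u).
Proof.
by move=> l m n; apply/val_inj; rewrite /= gmulA ?src_fibre ?rng_fibre.
Qed.
Fact fibre_mul1 u : left_id (fone u) (@fmul u).
Proof.
by move=> n; apply/val_inj; have := gmul1l (val n); rewrite rng_fibre.
Qed.
Fact fibre_mulr1 u : right_id (fone u) (@fmul u).
Proof.
by move=> n; apply/val_inj; have := gmul1r (val n); rewrite src_fibre.
Qed.
Fact fibre_mulV u : left_inverse (fone u) (@finv u) (@fmul u).
Proof. by move=> n; apply/val_inj; rewrite /= gmulVl src_fibre. Qed.
Fact fibre_mulVr u : right_inverse (fone u) (@finv u) (@fmul u).
Proof. by move=> n; apply/val_inj; rewrite /= gmulV rng_fibre. Qed.

HB.instance Definition _ u := isGroup.Build (fibre j u)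
  (@fibre_mulA u) (@fibre_mul1 u) (@fibre_mulr1 u)
  (@fibre_mulV u) (@fibre_mulVr u).

Lemma val_fibre1 u : val (1%g : fibre j u) = gid u. Proof. by []. Qed.
Lemma val_fibreM u (m n : fibre j u) : val (m * n)%g = gmul (val m) (val n).
Proof. by []. Qed.
Lemma val_fibreV u (n : fibre j u) : val (n^-1)%g = ginv (val n).
Proof. by []. Qed.

Context (k : normalized_section j).
Implicit Types x y : G.

Lemma rng_sec x : rng (k x) = rng x.
Proof. by rewrite -(ext_rng j) sec_cancel. Qed.
Lemma src_sec x : src (k x) = src x.
Proof. by rewrite -(ext_src j) sec_cancel. Qed.

Fact facL_subproof x (n : fibre j (src x)) :
  j (gmul (gmul (k x) (val n)) (ginv (k x))) == gid (rng x).
Proof.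
have kn : src (k x) = rng (val n) by rewrite src_sec rng_fibre.
rewrite ext_gmul; last by rewrite src_gmul// src_fibre rng_ginv src_sec.
rewrite ext_gmul// ext_ginv sec_cancel fibreP gmul1r gmulV.
exact: eqxx.
Qed.

(* [L_x] and its inverse. *)
Definition facL x (n : fibre j (src x)) : fibre j (rng x) :=
  exist _ (gmul (gmul (k x) (val n)) (ginv (k x))) (facL_subproof n).

Fact facLinv_subproof x (n : fibre j (rng x)) :
  j (gmul (gmul (ginv (k x)) (val n)) (k x)) == gid (src x).
Proof.
have kn : src (ginv (k x)) = rng (val n) by rewrite src_ginv rng_sec rng_fibre.
rewrite ext_gmul; last by rewrite src_gmul// src_fibre rng_sec.
rewrite ext_gmul// ext_ginv sec_cancel fibreP.
by rewrite -[in gmul _ (gid _)]src_ginv gmul1r gmulVl.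
Qed.

Definition facLinv x (n : fibre j (rng x)) : fibre j (src x) :=
  exist _ (gmul (gmul (ginv (k x)) (val n)) (k x)) (facLinv_subproof n).

Lemma facLK x : cancel (@facL x) (@facLinv x).
Proof.
move=> n; apply: val_inj => /=.
have kn : src (k x) = rng (val n) by rewrite src_sec rng_fibre.
have nk : src (val n) = rng (ginv (k x)) by rewrite src_fibre rng_ginv src_sec.
rewrite -(gmulA _ _ _ kn nk) gmulKl; last by rewrite rng_gmul.
by rewrite -[X in gmul _ X](ginvK (k x)) gmulKr.
Qed.

Lemma facLinvK x : cancel (@facLinv x) (@facL x).
Proof.
move=> n; apply: val_inj => /=.
have kn : src (ginv (k x)) = rng (val n) by rewrite src_ginv rng_sec rng_fibre.
have nk : src (val n) = rng (k x) by rewrite src_fibre rng_sec.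
rewrite -(gmulA _ _ _ kn nk) -[X in gmul (gmul X _) _](ginvK (k x)).
by rewrite gmulKl ?rng_gmul// gmulKr.
Qed.

Lemma facLM x : {morph @facL x : m n / (m * n)%g}.
Proof.
move=> m n; apply: val_inj => /=.
have km : src (k x) = rng (val m) by rewrite src_sec rng_fibre.
have kn : src (k x) = rng (val n) by rewrite src_sec rng_fibre.
have mn : src (val m) = rng (val n) by rewrite src_fibre rng_fibre.
have mk : src (val m) = rng (ginv (k x)) by rewrite src_fibre rng_ginv src_sec.
have nk : src (val n) = rng (ginv (k x)) by rewrite src_fibre rng_ginv src_sec.
have kmn : src (gmul (k x) (val m)) = rng (val n) by rewrite src_gmul.
have kmk : src (gmul (k x) (val m)) = rng (ginv (k x)) by rewrite src_gmul.
have knk : src (gmul (k x) (val n)) = rng (ginv (k x)) by rewrite src_gmul.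
have kkn : rng (gmul (gmul (k x) (val n)) (ginv (k x))) = rng (k x).
  by rewrite rng_gmul// rng_gmul.
rewrite (gmulA _ _ _ km mn) -(gmulA _ _ _ kmn nk).
rewrite -(gmulA _ _ _ kmk) ?src_ginv ?kkn//; congr gmul.
by rewrite -(gmulA _ _ _ kn nk) gmulKl// rng_gmul.
Qed.

Fact sigma_subproof x y (xy : src x = rng y) :
  j (gmul (gmul (k x) (k y)) (ginv (k (gmul x y)))) == gid (rng x).
Proof.
have kxy : src (k x) = rng (k y) by rewrite src_sec rng_sec.
rewrite ext_gmul; last by rewrite src_gmul// rng_ginv !src_sec src_gmul.
by rewrite ext_gmul// ext_ginv !sec_cancel gmulV rng_gmul.
Qed.

Definition sigma x y (xy : src x = rng y) : fibre j (rng x) :=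
  exist _ (gmul (gmul (k x) (k y)) (ginv (k (gmul x y)))) (sigma_subproof xy).

Lemma sigmaE x y (xy : src x = rng y) :
  gmul (k x) (k y) = gmul (val (sigma xy)) (k (gmul x y)).
Proof.
have kxy : src (k x) = rng (k y) by rewrite src_sec rng_sec.
rewrite /= -[X in _ = gmul _ X]ginvK gmulKr//.
by rewrite src_gmul// rng_ginv !src_sec src_gmul.
Qed.

End Fibre.
Arguments facL {U E G j} k x n.
Arguments facLinv {U E G j} k x n.
Arguments sigma {U E G j} k {x y} xy.

(* Composable pairs with product [z]. *)
Definition factorizations (U : choiceType) (G : groupoidType U) (z : G) : Type :=
  {p : G * G | (src p.1 == rng p.2) && (gmul p.1 p.2 == z)}.
HB.instance Definition _ (U : choiceType) (G : groupoidType U) (z : G) :=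
  Choice.on (factorizations z).

Section Factorizations.
Context {U : choiceType} {G : groupoidType U} {z : G} (p : factorizations z).

Definition fac1 : G := (val p).1.
Definition fac2 : G := (val p).2.

Lemma fac_src : src fac1 = rng fac2.
Proof. by have /andP[/eqP ? _] := valP p. Qed.
Lemma fac_mul : gmul fac1 fac2 = z.
Proof. by have /andP[_ /eqP ?] := valP p. Qed.
Lemma fac_rng : rng fac1 = rng z.
Proof. by rewrite -fac_mul rng_gmul// fac_src. Qed.

End Factorizations.

Section CrossedProduct.
Context (R : realType) {U : choiceType} {E G : groupoidType U}.
Context {j : extension E G} (k : normalized_section j).

Local Notation "'C[N_' u ]" := (group_algebra R (fibre j u)) (format "'C[N_' u ]").

(* Identification of the fibres over equal units. *)
Definition transport (u v : U) (e : u = v) (f : C[N_u]) : C[N_v] :=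
  ecast w (C[N_w]) e f.

Fact facM_fin (x : G) (f : C[N_(src x)]) :
  finite_set [set n | f (facLinv k x n) != 0].
Proof.
apply: sub_finite_set (finite_image (facL k x) (fsprod_fin f)).
by move=> n /= fn; exists (facLinv k x n) => //; exact: facLinvK.
Qed.

(* [M_x f], i.e. [f] composed with the inverse of [L_x]. *)
Definition facM (x : G) (f : C[N_(src x)]) : C[N_(rng x)] :=
  FsProd _ (facM_fin f).

Definition tau (x y : G) (xy : src x = rng y) : C[N_(rng x)] :=
  delta R (sigma k xy).

Definition tau_inv (x y : G) (xy : src x = rng y) : C[N_(rng x)] :=
  delta R (sigma k xy)^-1%g.

Lemma tau_mulV (x y : G) (xy : src x = rng y) :
  tau xy ** tau_inv xy = delta R 1%g /\ tau_inv xy ** tau xy = delta R 1%g.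
Proof. by rewrite /tau /tau_inv !delta_mul mulgV mulVg. Qed.

(* The section occurs in the type because the product and the involution below
   depend on it. *)
Definition crossed_product (_ : normalized_section j) : Type :=
  fsprod (fun x : G => C[N_(rng x)]).
HB.instance Definition _ := NormedModule.on (crossed_product k).
Implicit Types f g : crossed_product k.

(* The summand [f x ** M_x (g y) ** tau x y] of [(f ** g) z] for [x y = z]. *)
Definition cp_term f g (z : G) (p : factorizations z) : C[N_(rng z)] :=
  let x := fac1 p in let y := fac2 p in
  transport (fac_rng p)
    (f x ** facM (transport (esym (fac_src p)) (g y)) ** tau (fac_src p)).

Definition cp_mul_fun f g (z : G) : C[N_(rng z)] :=
  \sum_(p \in [set: factorizations z]) cp_term f g p.

Definition cp_star_fun f (x : G) : C[N_(rng x)] :=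
  tau_inv (esym (rng_ginv x))
    ** astar (facM (transport (rng_ginv x) (f (ginv x)))).

Lemma ga_mul0l (H : groupType) (f : group_algebra R H) : 0 ** f = 0.
Proof.
by apply: fsprodP => n /=; apply: fsbig1 => p _; rewrite mul0r.
Qed.
Lemma ga_mul0r (H : groupType) (f : group_algebra R H) : f ** 0 = 0.
Proof.
by apply: fsprodP => n /=; apply: fsbig1 => p _; rewrite mulr0.
Qed.
Lemma ga_star0 (H : groupType) : astar (0 : group_algebra R H) = 0.
Proof. by apply: fsprodP => n /=; rewrite rmorph0. Qed.
Lemma facM0 x : facM (0 : C[N_(src x)]) = 0.
Proof. exact: fsprodP. Qed.
Lemma transport0 u v (e : u = v) : transport e 0 = 0.
Proof. by case: v / e. Qed.

Fact cp_mul_fin f g : finite_set [set z | cp_mul_fun f g z != 0].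
Proof.
have fin := finite_setX (fsprod_fin f) (fsprod_fin g).
apply: sub_finite_set (finite_image (fun p => gmul p.1 p.2) fin).
move=> z /= /fsbig_neq0[p _ p0]; exists (fac1 p, fac2 p); last exact: fac_mul.
split => /=; apply: contraNN p0 => /eqP h; rewrite /cp_term h ?transport0 ?facM0.
  by rewrite !ga_mul0l transport0.
by rewrite ga_mul0r ga_mul0l transport0.
Qed.

Fact cp_star_fin f : finite_set [set x | cp_star_fun f x != 0].
Proof.
apply: sub_finite_set (finite_image (fun e : G => ginv e) (fsprod_fin f)).
move=> x /= fx; exists (ginv x); rewrite ?ginvK//.
apply: contraNN fx => /eqP; rewrite /cp_star_fun => ->.
by rewrite transport0 facM0 ga_star0 ga_mul0r.
Qed.

HB.instance Definition _ := hasProdStar.Build (crossed_product k)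
  (fun f g => FsProd _ (cp_mul_fin f g)) (fun f => FsProd _ (cp_star_fin f)).

Fact Phi_fibre_fin (f : groupoid_algebra R E) (x : G) :
  finite_set [set n : fibre j (rng x) | f (gmul (val n) (k x)) != 0].
Proof.
apply: (finite_preimage (B := [set e | f e != 0])
  (f := fun n : fibre j (rng x) => gmul (val n) (k x))); last exact: fsprod_fin.
have nk (n : fibre j (rng x)) : src (val n) = rng (k x).
  by rewrite src_fibre rng_sec.
by move=> m n _ _ mn; apply: val_inj; rewrite -(gmulKr (nk m)) mn gmulKr.
Qed.

Definition Phi_fibre (f : groupoid_algebra R E) (x : G) : C[N_(rng x)] :=
  FsProd _ (Phi_fibre_fin f x).

Fact Phi_fin (f : groupoid_algebra R E) :
  finite_set [set x | Phi_fibre f x != 0].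
Proof.
apply: sub_finite_set (finite_image j (fsprod_fin f)) => x /= fx.
apply: contrapT => h; move/eqP: fx; apply; apply: fsprodP => n /=.
apply: contrapT => /eqP fn; apply: h; exists (gmul (val n) (k x)) => //.
rewrite ext_gmul ?src_fibre ?rng_sec// fibreP sec_cancel.
by rewrite gmul1l.
Qed.

Definition Phi (f : groupoid_algebra R E) : crossed_product k :=
  FsProd _ (Phi_fin f).

End CrossedProduct.
Arguments crossed_product R {U E G j} k.
Arguments Phi R {U E G j} k f.

(* The norms of [a] in the contractive *-representations of [A] in C*-algebras;
   [cstar_norm] is their supremum. *)
Definition cstar_norms (R : realType) (A : normedStarType R) (a : A) : set R :=
  [set r | exists (B : cstarAlgType R) (phi : A -> B),
    [/\ is_star_hom phi, forall b, `|phi b| <= `|b| & `|phi a| = r%:C]].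

Definition cstar_norm (R : realType) (A : normedStarType R) (a : A) : R :=
  sup (cstar_norms a).

Section CStarNorm.
Context {R : realType} {A : normedStarType R}.
Implicit Types (a b : A) (r : R) (z : R[i]).

Local Notation re := complex.Re.

Lemma ge0_re z : 0 <= z -> z = (re z)%:C.
Proof. by case: z => x y; rewrite lecE/= => /andP[/eqP h _]; rewrite h. Qed.

Lemma normr_re (V : normedModType R[i]) (v : V) : `|v| = (re `|v|)%:C.
Proof. exact: ge0_re. Qed.

Lemma re_ge0 (V : normedModType R[i]) (v : V) : 0 <= re `|v|.
Proof. by rewrite -lecR -normr_re; exact: normr_ge0. Qed.

Lemma star_hom0 (B C : normedStarType R) (phi : B -> C) :
  is_star_hom phi -> phi 0 = 0.
Proof. by move=> h; have := star_homZ h 0 0; rewrite !scale0r. Qed.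

Lemma star_homN (B C : normedStarType R) (phi : B -> C) :
  is_star_hom phi -> {morph phi : a / - a}.
Proof. by move=> h a; have := star_homZ h (-1) a; rewrite !scaleN1r. Qed.

Lemma star_homB (B C : normedStarType R) (phi : B -> C) :
  is_star_hom phi -> {morph phi : a b / a - b}.
Proof. by move=> h a b; rewrite (star_homD h) (star_homN h). Qed.

Lemma cstar_norms_ub a : ubound (cstar_norms a) (re `|a|).
Proof.
by move=> r [B [phi [_ le er]]]; rewrite -lecR -normr_re -er.
Qed.

Lemma cstar_norm_le a r : 0 <= r ->
  (forall (B : cstarAlgType R) (phi : A -> B), is_star_hom phi ->
    (forall b, `|phi b| <= `|b|) -> `|phi a| <= r%:C) ->
  cstar_norm a <= r.
Proof.
move=> r0 H; have [e|/set0P ne] := eqVneq (cstar_norms a) set0.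
  by rewrite /cstar_norm e sup0.
by apply: ge_sup => // s [B [phi [h c e]]]; rewrite -lecR -e H.
Qed.

Lemma le_cstar_norm a (B : cstarAlgType R) (phi : A -> B) : is_star_hom phi ->
  (forall b, `|phi b| <= `|b|) -> `|phi a| <= (cstar_norm a)%:C.
Proof.
move=> h c; rewrite (normr_re (phi a)) lecR; apply: ub_le_sup.
  by exists (re `|a|); exact: cstar_norms_ub.
by exists B, phi; split => //; exact: normr_re.
Qed.

Lemma cstar_norm_ge0 a : 0 <= cstar_norm a.
Proof.
have [e|/set0P[r hr]] := eqVneq (cstar_norms a) set0.
  by rewrite /cstar_norm e sup0.
have [B [phi [h c e]]] := hr.
by rewrite -lecR (le_trans _ (le_cstar_norm a h c))//; exact: normr_ge0.
Qed.

Lemma cstar_normD a b : cstar_norm (a + b) <= cstar_norm a + cstar_norm b.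
Proof.
apply: cstar_norm_le => [|B phi h c].
  by rewrite addr_ge0 ?cstar_norm_ge0.
rewrite (star_homD h) (le_trans (ler_normD _ _))// rmorphD/=.
by rewrite lerD// le_cstar_norm.
Qed.

Lemma cstar_normM a b : cstar_norm (a ** b) <= cstar_norm a * cstar_norm b.
Proof.
apply: cstar_norm_le => [|B phi h c].
  by rewrite mulr_ge0 ?cstar_norm_ge0.
rewrite (star_homM h) (le_trans (normr_amul _ _))// rmorphM/=.
by rewrite ler_pM// le_cstar_norm.
Qed.

Lemma amulBl (B : cstarAlgType R) (x y t : B) : (x - y) ** t = x ** t - y ** t.
Proof. by rewrite amulDl -(scaleN1r y) amulZl scaleN1r. Qed.

Lemma amulBr (B : cstarAlgType R) (x y t : B) : t ** (x - y) = t ** x - t ** y.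
Proof. by rewrite amulDr -(scaleN1r y) amulZr scaleN1r. Qed.

Lemma astarB (B : cstarAlgType R) (x y : B) : astar (x - y) = astar x - astar y.
Proof.
by rewrite astarD -(scaleN1r y) astarZ rmorphN rmorph1 scaleN1r.
Qed.

Lemma normr_astar (B : cstarAlgType R) (b : B) : `|astar b| = `|b|.
Proof.
have le (x : B) : `|x| <= `|astar x|.
  have [->|x0] := eqVneq x 0; first by rewrite normr0.
  rewrite -(ler_pM2r (_ : 0 < `|x|)) ?normr_gt0//.
  by rewrite -expr2 -normr_cstar normr_amul.
by apply/eqP; rewrite eq_le le andbT -[in leRHS](astarK b) le.
Qed.

Lemma cstar_normS_le a : cstar_norm (astar a) <= cstar_norm a.
Proof.
apply: cstar_norm_le => [|B phi h c]; first exact: cstar_norm_ge0.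
by rewrite (star_homS h) normr_astar le_cstar_norm.
Qed.

Lemma cstar_norm_cstar a : cstar_norm a ^+ 2 <= cstar_norm (astar a ** a).
Proof.
rewrite -(@ler_sqrt R) ?sqr_ge0 ?cstar_norm_ge0//.
rewrite sqrtr_sqr ger0_norm ?cstar_norm_ge0//.
apply: cstar_norm_le => [|B phi h c]; first exact: sqrtr_ge0.
rewrite -(@ler_pXn2r _ 2)// ?nnegrE ?normr_ge0 ?lecR ?sqrtr_ge0//.
rewrite -rmorphXn sqr_sqrtr ?cstar_norm_ge0//.
by rewrite -normr_cstar -(star_homS h) -(star_homM h) le_cstar_norm.
Qed.

Lemma cstar_normZ_le z a : cstar_norm (z *: a) <= re `|z : R[i]^o| * cstar_norm a.
Proof.
apply: cstar_norm_le => [|B phi h c].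
  by rewrite mulr_ge0 ?cstar_norm_ge0// re_ge0.
rewrite (star_homZ h) normrZ rmorphM/=.
by rewrite -(normr_re (z : R[i]^o)) ler_wpM2l// le_cstar_norm.
Qed.

Lemma cstar_norm_eq0 a :
  (forall (B : cstarAlgType R) (phi : A -> B), is_star_hom phi -> phi a = 0) ->
  cstar_norm a = 0.
Proof.
move=> H; apply/eqP; rewrite eq_le cstar_norm_ge0 andbT.
by apply: cstar_norm_le => // B phi h c; rewrite H// normr0.
Qed.

Lemma cstar_norm_eq a b :
  (forall (B : cstarAlgType R) (phi : A -> B), is_star_hom phi -> phi a = phi b) ->
  cstar_norm (a - b) = 0.
Proof.
move=> H; apply: cstar_norm_eq0 => B phi h.
by rewrite (star_homB h) (H _ _ h) subrr.
Qed.

Lemma cstar_norm0 : cstar_norm (0 : A) = 0.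
Proof. by apply: cstar_norm_eq0 => B phi; exact: star_hom0. Qed.

Lemma cstar_normN a : cstar_norm (- a) = cstar_norm a.
Proof.
have le b : cstar_norm (- b) <= cstar_norm b.
  apply: cstar_norm_le => [|B phi h c]; first exact: cstar_norm_ge0.
  by rewrite (star_homN h) normrN le_cstar_norm.
by apply/eqP; rewrite eq_le le -[in leLHS](opprK a) le.
Qed.

Lemma cstar_distC a b : cstar_norm (a - b) = cstar_norm (b - a).
Proof. by rewrite -cstar_normN opprB. Qed.

Lemma cstar_dist_trans b a c :
  cstar_norm (a - c) <= cstar_norm (a - b) + cstar_norm (b - c).
Proof. by rewrite (le_trans _ (cstar_normD _ _))// addrA subrK. Qed.

Lemma cstar_lerB_dist a b : cstar_norm a - cstar_norm b <= cstar_norm (a - b).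
Proof. by rewrite lerBlDr (le_trans _ (cstar_normD _ _))// subrK. Qed.

Lemma cstar_dist_dist a b : `|cstar_norm a - cstar_norm b| <= cstar_norm (a - b).
Proof.
rewrite ler_norml cstar_lerB_dist andbT lerNl opprB cstar_distC.
exact: cstar_lerB_dist.
Qed.

Lemma cstar_normB_le a b c d : cstar_norm ((a + b) - (c + d)) <=
  cstar_norm (a - c) + cstar_norm (b - d).
Proof. by rewrite opprD addrACA cstar_normD. Qed.

Lemma cstar_normN_dist a b : cstar_norm (- a - - b) = cstar_norm (a - b).
Proof. by rewrite -opprD cstar_normN. Qed.

Lemma cstar_normM_le a b c d : cstar_norm (a ** b - c ** d) <=
  cstar_norm (a - c) * cstar_norm b + cstar_norm c * cstar_norm (b - d).
Proof.
apply: cstar_norm_le => [|B phi h cphi].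
  by rewrite addr_ge0// mulr_ge0 ?cstar_norm_ge0.
rewrite (star_homB h) !(star_homM h).
have -> : phi a ** phi b - phi c ** phi d =
    phi (a - c) ** phi b + phi c ** phi (b - d).
  by rewrite !(star_homB h) amulBl amulBr addrA subrK.
rewrite (le_trans (ler_normD _ _))// rmorphD !rmorphM/=.
apply: lerD; rewrite (le_trans (normr_amul _ _))//;
  by rewrite ler_pM// le_cstar_norm.
Qed.

Lemma cstar_normS_dist a b :
  cstar_norm (astar a - astar b) <= cstar_norm (a - b).
Proof.
apply: cstar_norm_le => [|B phi h c]; first exact: cstar_norm_ge0.
have -> : phi (astar a - astar b) = astar (phi (a - b)).
  by rewrite !(star_homB h) !(star_homS h) astarB.
by rewrite normr_astar le_cstar_norm.
Qed.

Lemma cstar_normZ_dist z a b :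
  cstar_norm (z *: a - z *: b) <= re `|z : R[i]^o| * cstar_norm (a - b).
Proof. by rewrite -scalerBr cstar_normZ_le. Qed.

End CStarNorm.

Section Envelope.
Context {R : realType} {A : normedStarType R}.
Local Notation p := (@cstar_norm R A).
Local Notation re := complex.Re.

Definition cstar_cauchy (u : nat -> A) := forall e : R, 0 < e ->
  exists N, forall m n, (N <= m)%N -> (N <= n)%N -> p (u m - u n) < e.

Record cstar_seq := CstarSeq {
  cseq_fun :> nat -> A;
  cseqP : cstar_cauchy cseq_fun
}.
HB.instance Definition _ := gen_eqMixin cstar_seq.
HB.instance Definition _ := gen_choiceMixin cstar_seq.
Implicit Types (u v w : cstar_seq) (z : R[i]) (a b : A).

Lemma cseq_cvg u : cvgn (fun n => p (u n)).
Proof.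
apply/cauchy_cvgP/cauchyP => e e0.
have [N uN] := cseqP u e0; exists (p (u N)); exists N => // n /= Nn.
by rewrite -ball_normE /ball_/= (le_lt_trans (cstar_dist_dist _ _))// uN.
Qed.

Definition cseq_norm u : R := limn (fun n => p (u n)).

Lemma cseq_normP u : p (u n) @[n --> \oo] --> cseq_norm u.
Proof. exact: cseq_cvg. Qed.
Arguments cseq_normP : clear implicits.

Lemma cseq_norm_ge0 u : 0 <= cseq_norm u.
Proof.
apply: limr_ge; first exact: cseq_cvg.
by apply: nearW => n; exact: cstar_norm_ge0.
Qed.

Lemma cseq_norm_le u (f : nat -> R) (l : R) :
  f @ \oo --> l -> (forall n, p (u n) <= f n) -> cseq_norm u <= l.
Proof.
by move=> fl le; apply: (ler_cvg_to (cseq_normP u) fl); exact: nearW.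
Qed.

Lemma cseq_norm_eq u (f : nat -> R) (l : R) :
  f @ \oo --> l -> (forall n, p (u n) = f n) -> cseq_norm u = l.
Proof.
move=> fl le; rewrite /cseq_norm (_ : (fun n => p (u n)) = f); last exact/funext.
exact: cvg_lim.
Qed.

Fact cseq_cst_subproof a : cstar_cauchy (fun _ => a).
Proof. by move=> e e0; exists 0%N => m n _ _; rewrite subrr cstar_norm0. Qed.
Fact cseq_add_subproof u v : cstar_cauchy (fun n => u n + v n).
Proof.
move=> e e0; have e20 : 0 < e / 2 by rewrite divr_gt0.
have [M uM] := cseqP u e20; have [N vN] := cseqP v e20.
exists (maxn M N) => m n; rewrite !geq_max => /andP[Mm Nm] /andP[Mn Nn].
rewrite (le_lt_trans (cstar_normB_le _ _ _ _))// [ltRHS](splitr e).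
by rewrite ltrD// ?uM ?vN.
Qed.
Fact cseq_opp_subproof u : cstar_cauchy (fun n => - u n).
Proof.
move=> e e0; have [N uN] := cseqP u e0; exists N => m n Nm Nn.
by rewrite cstar_normN_dist uN.
Qed.
Fact cseq_scale_subproof z u : cstar_cauchy (fun n => z *: u n).
Proof.
move=> e e0; set c := re `|z : R[i]^o|.
have c0 : 0 <= c by exact: re_ge0.
have c1 : 0 < c + 1 by rewrite ltr_wpDl.
have [N uN] := cseqP u (divr_gt0 e0 c1); exists N => m n Nm Nn.
rewrite (le_lt_trans (cstar_normZ_dist _ _ _))// -/c.
have := uN m n Nm Nn; rewrite ltr_pdivlMr// mulrC; apply: le_lt_trans.
by rewrite ler_wpM2r ?cstar_norm_ge0// lerDl.
Qed.
Fact cseq_star_subproof u : cstar_cauchy (fun n => astar (u n)).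
Proof.
move=> e e0; have [N uN] := cseqP u e0; exists N => m n Nm Nn.
by rewrite (le_lt_trans (cstar_normS_dist _ _))// uN.
Qed.
Lemma cseq_bounded u : exists2 M, 0 < M & exists N, forall n, (N <= n)%N -> p (u n) <= M.
Proof.
have [N uN] := cseqP u ltr01; exists (p (u N) + 1).
  by rewrite ltr_wpDl ?cstar_norm_ge0.
exists N => n Nn; rewrite -lerBlDl ltW//.
by rewrite (le_lt_trans (cstar_lerB_dist _ _))// uN.
Qed.
Fact cseq_mul_subproof u v : cstar_cauchy (fun n => u n ** v n).
Proof.
move=> e e0.
have [B B0 [N1 uB]] := cseq_bounded u; have [C C0 [N2 vC]] := cseq_bounded v.
have e20 : 0 < e / 2 by rewrite divr_gt0.
have [N3 uN] := cseqP u (divr_gt0 e20 C0).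
have [N4 vN] := cseqP v (divr_gt0 e20 B0).
exists (maxn (maxn N1 N2) (maxn N3 N4)) => m n; rewrite !geq_max.
move=> /andP[/andP[m1 m2] /andP[m3 m4]] /andP[/andP[n1 n2] /andP[n3 n4]].
rewrite (le_lt_trans (cstar_normM_le _ _ _ _))// [ltRHS](splitr e) ltr_leD//.
  rewrite (le_lt_trans (ler_wpM2l _ (vC _ m2))) ?cstar_norm_ge0//.
  by rewrite -ltr_pdivlMr// uN.
rewrite (le_trans (ler_wpM2r _ (uB _ n1))) ?cstar_norm_ge0//.
by rewrite mulrC -ler_pdivlMr// ltW// vN.
Qed.

Let cst a := CstarSeq (cseq_cst_subproof a).
Let cadd u v := CstarSeq (cseq_add_subproof u v).
Let copp u := CstarSeq (cseq_opp_subproof u).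
Let cscale z u := CstarSeq (cseq_scale_subproof z u).
Let cstar u := CstarSeq (cseq_star_subproof u).
Let cmul u v := CstarSeq (cseq_mul_subproof u v).
Let csub u v := cadd u (copp v).

Definition cseq_equiv u v := cseq_norm (csub u v) == 0.

Lemma cseq_norm_le0 u : cseq_norm u <= 0 -> cseq_norm u = 0.
Proof. by move=> h; apply/eqP; rewrite eq_le h cseq_norm_ge0. Qed.

Lemma cseq_equiv_pw u v : (forall n, p (u n - v n) = 0) -> cseq_equiv u v.
Proof.
by move=> h; apply/eqP; apply: (@cseq_norm_eq _ (fun=> 0)) => //; exact: cvg_cst.
Qed.

Fact cseq_equiv_refl : reflexive cseq_equiv.
Proof. by move=> u; apply: cseq_equiv_pw => n; rewrite subrr cstar_norm0. Qed.
Fact cseq_equiv_sym : symmetric cseq_equiv.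
Proof.
move=> u v; congr (_ == _); apply: cseq_norm_eq (cseq_normP (csub v u)) _ => n.
exact: cstar_distC.
Qed.
Fact cseq_equiv_trans : transitive cseq_equiv.
Proof.
move=> v u w /eqP uv /eqP vw; apply/eqP/cseq_norm_le0.
have -> : 0 = cseq_norm (csub u v) + cseq_norm (csub v w) :> R.
  by rewrite uv vw addr0.
apply: cseq_norm_le; first exact: cvgD (cseq_normP (csub u v)) (cseq_normP (csub v w)).
by move=> n; exact: cstar_dist_trans.
Qed.

Canonical cseq_equiv_rel :=
  EquivRel cseq_equiv cseq_equiv_refl cseq_equiv_sym cseq_equiv_trans.

(* The enveloping C*-algebra of [A] is the Hausdorff completion of [A] for
   [cstar_norm]: Cauchy sequences modulo null sequences. *)
Definition envelope : Type := {eq_quot cseq_equiv}%qT.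
HB.instance Definition _ := Choice.on envelope.
HB.instance Definition _ := EqQuotient.on envelope.
Implicit Types x y : envelope.

Local Notation pi := (\pi_envelope)%qT.

Lemma piP u v : pi u = pi v <-> cseq_norm (csub u v) = 0.
Proof. by split => [/eqmodP/eqP|h]//; apply/eqmodP/eqP. Qed.

Lemma pi_pw u v : (forall n, p (u n - v n) = 0) -> pi u = pi v.
Proof. by move=> h; apply/eqmodP; exact: cseq_equiv_pw. Qed.

Lemma repr_pi u : cseq_norm (csub (repr (pi u)) u) = 0.
Proof. by apply/piP; rewrite reprK. Qed.

Let eadd x y : envelope := pi (cadd (repr x) (repr y)).
Let eopp x : envelope := pi (copp (repr x)).
Let escale z x : envelope := pi (cscale z (repr x)).
Let emul x y : envelope := pi (cmul (repr x) (repr y)).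
Let estar x : envelope := pi (cstar (repr x)).
Let enorm x : R := cseq_norm (repr x).

Lemma enormE u : enorm (pi u) = cseq_norm u.
Proof.
have h := repr_pi u; apply/eqP; rewrite /enorm -subr_eq0 -normr_le0 -h.
apply: (ler_cvg_to (cvg_norm (cvgB (cseq_normP (repr (pi u))) (cseq_normP u)))).
  exact: (cseq_normP (csub (repr (pi u)) u)).
by apply: nearW => n; exact: cstar_dist_dist.
Qed.

Lemma eaddE u v : eadd (pi u) (pi v) = pi (cadd u v).
Proof.
apply/piP/cseq_norm_le0; set u' := repr _; set v' := repr _.
have -> : 0 = cseq_norm (csub u' u) + cseq_norm (csub v' v) :> R.
  by rewrite !repr_pi addr0.
apply: cseq_norm_le (cvgD (cseq_normP (csub u' u)) (cseq_normP (csub v' v))) _.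
by move=> n; exact: cstar_normB_le.
Qed.

Lemma eoppE u : eopp (pi u) = pi (copp u).
Proof.
apply/piP/cseq_norm_le0; set u' := repr _; rewrite -(repr_pi u).
apply: cseq_norm_le (cseq_normP (csub u' u)) _ => n.
by rewrite /= cstar_normN_dist.
Qed.

Lemma escaleE z u : escale z (pi u) = pi (cscale z u).
Proof.
apply/piP/cseq_norm_le0; set u' := repr _.
have -> : 0 = re `|z : R[i]^o| * cseq_norm (csub u' u) :> R.
  by rewrite repr_pi mulr0.
apply: cseq_norm_le (cvgM (cvg_cst _) (cseq_normP (csub u' u))) _ => n.
exact: cstar_normZ_dist.
Qed.

Lemma estarE u : estar (pi u) = pi (cstar u).
Proof.
apply/piP/cseq_norm_le0; set u' := repr _; rewrite -(repr_pi u).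
apply: cseq_norm_le (cseq_normP (csub u' u)) _ => n.
exact: cstar_normS_dist.
Qed.

Lemma emulE u v : emul (pi u) (pi v) = pi (cmul u v).
Proof.
apply/piP/cseq_norm_le0; set u' := repr _; set v' := repr _.
have -> : 0 = cseq_norm (csub u' u) * cseq_norm v' +
              cseq_norm u * cseq_norm (csub v' v) :> R.
  by rewrite !repr_pi mul0r mulr0 addr0.
apply: cseq_norm_le (cvgD (cvgM (cseq_normP (csub u' u)) (cseq_normP v'))
  (cvgM (cseq_normP u) (cseq_normP (csub v' v)))) _.
by move=> n; exact: cstar_normM_le.
Qed.

Let quotP (P : envelope -> Prop) : (forall u, P (pi u)) -> forall x, P x.
Proof. by move=> h x; rewrite -[x]reprK. Qed.

Fact envelope_addA : associative eadd.
Proof.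
elim/quotP => u; elim/quotP => v; elim/quotP => w.
by rewrite !eaddE; apply: pi_pw => n; rewrite /= addrA subrr cstar_norm0.
Qed.
Fact envelope_addC : commutative eadd.
Proof.
elim/quotP => u; elim/quotP => v.
by rewrite !eaddE; apply: pi_pw => n; rewrite /= (addrC (u n)) subrr cstar_norm0.
Qed.
Fact envelope_add0 : left_id (pi (cst 0)) eadd.
Proof.
elim/quotP => u.
by rewrite !eaddE; apply: pi_pw => n; rewrite /= add0r subrr cstar_norm0.
Qed.
Fact envelope_addN : left_inverse (pi (cst 0)) eopp eadd.
Proof.
elim/quotP => u.
by rewrite eoppE eaddE; apply: pi_pw => n; rewrite /= addNr subrr cstar_norm0.
Qed.

HB.instance Definition _ := GRing.isZmodule.Build envelope
  envelope_addA envelope_addC envelope_add0 envelope_addN.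

Lemma envelopeD u v : pi u + pi v = pi (cadd u v).
Proof. exact: eaddE. Qed.

Fact envelope_scaleA z z' x : escale z (escale z' x) = escale (z * z') x.
Proof.
elim/quotP: x => u.
by rewrite !escaleE; apply: pi_pw => n; rewrite /= scalerA subrr cstar_norm0.
Qed.
Fact envelope_scale1 : left_id 1 escale.
Proof.
elim/quotP => u.
by rewrite !escaleE; apply: pi_pw => n; rewrite /= scale1r subrr cstar_norm0.
Qed.
Fact envelope_scaleDr : right_distributive escale +%R.
Proof.
move=> z; elim/quotP => u; elim/quotP => v.
rewrite !(envelopeD, escaleE); apply: pi_pw => n.
by rewrite /= scalerDr subrr cstar_norm0.
Qed.
Fact envelope_scaleDl x : {morph escale^~ x : z z' / z + z'}.
Proof.
move=> z z'; elim/quotP: x => u.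
rewrite !(envelopeD, escaleE); apply: pi_pw => n.
by rewrite /= scalerDl subrr cstar_norm0.
Qed.

HB.instance Definition _ := GRing.Zmodule_isLmodule.Build R[i] envelope
  envelope_scaleA envelope_scale1 envelope_scaleDr envelope_scaleDl.

Lemma envelopeZ z u : z *: pi u = pi (cscale z u).
Proof. exact: escaleE. Qed.

Fact envelope_ler_normD x y : (enorm (x + y))%:C <= (enorm x)%:C + (enorm y)%:C.
Proof.
elim/quotP: x => u; elim/quotP: y => v; rewrite envelopeD !enormE.
rewrite -rmorphD/= lecR.
apply: cseq_norm_le (cvgD (cseq_normP u) (cseq_normP v)) _ => n.
exact: cstar_normD.
Qed.

Lemma cstar_normZ z a : p (z *: a) = re `|z : R[i]^o| * p a.
Proof.
apply/eqP; rewrite eq_le cstar_normZ_le andTb.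
have [->|z0] := eqVneq z 0; first by rewrite normr0 raddf0 mul0r cstar_norm_ge0.
have c0 : 0 < re `|z : R[i]^o| by rewrite -ltcR -normr_re normr_gt0.
rewrite mulrC -ler_pdivlMr// mulrC.
rewrite -[in leLHS](scalerK z0 a) (le_trans (cstar_normZ_le _ _))//.
have -> // : re `|z^-1 : R[i]^o| = (re `|z : R[i]^o|)^-1.
apply: (@complexI R); rewrite fmorphV.
apply: etrans (esym (normr_re (z^-1 : R[i]^o))) _.
exact: etrans (normfV z) (congr1 GRing.inv (normr_re (z : R[i]^o))).
Qed.

Fact envelope_normrZ z x : (enorm (z *: x))%:C = `|z| * (enorm x)%:C.
Proof.
elim/quotP: x => u; rewrite envelopeZ !enormE.
have -> : `|z| = (re `|z : R[i]^o|)%:C by exact: normr_re (z : R[i]^o).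
suff -> : cseq_norm (cscale z u) = re `|z : R[i]^o| * cseq_norm u.
  by rewrite rmorphM.
apply: cseq_norm_eq (cvgM (cvg_cst _) (cseq_normP u)) _ => n.
exact: cstar_normZ.
Qed.

Fact envelope_normr0_eq0 x : (enorm x)%:C = 0 -> x = 0.
Proof.
elim/quotP: x => u /(@complexI R _ 0); rewrite enormE => u0.
apply/piP; apply: cseq_norm_le0; rewrite -u0.
by apply: cseq_norm_le (cseq_normP u) _ => n; rewrite /= subr0.
Qed.

HB.instance Definition _ := Lmodule_isNormed.Build R[i] envelope
  envelope_ler_normD envelope_normrZ envelope_normr0_eq0.
HB.instance Definition _ := hasProdStar.Build envelope emul estar.

Lemma envelopeM u v : pi u ** pi v = pi (cmul u v).
Proof. exact: emulE. Qed.

Lemma envelopeS u : astar (pi u) = pi (cstar u).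
Proof. exact: estarE. Qed.

Definition to_envelope a : envelope := pi (cst a).

Lemma envelope_normE u : `|pi u| = (cseq_norm u)%:C.
Proof. by rewrite -enormE. Qed.

Lemma norm_to_envelope a : `|to_envelope a| = (p a)%:C.
Proof.
by rewrite envelope_normE; congr (_%:C); apply: cseq_norm_eq (cvg_cst _) _.
Qed.

Lemma envelopeB u v : pi u - pi v = pi (csub u v).
Proof. by rewrite -envelopeD -eoppE. Qed.

Lemma to_envelopeB a b : to_envelope a - to_envelope b = to_envelope (a - b).
Proof.
by rewrite envelopeB; apply: pi_pw => n; rewrite /= subrr cstar_norm0.
Qed.

Lemma to_envelope_cvg u (e : R) : 0 < e ->
  exists N, forall n, (N <= n)%N -> `|pi u - to_envelope (u n)| <= e%:C.
Proof.
move=> e0; have [N uN] := cseqP u e0; exists N => n Nn.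
rewrite envelopeB envelope_normE lecR.
apply: (ler_cvg_to (cseq_normP _) (@cvg_cst _ _ _ _ _)).
by exists N => // m /= Nm; rewrite ltW// uN.
Qed.

Lemma to_envelope_hom : is_star_hom to_envelope.
Proof.
by split=> [a b|z a|a b|a];
  rewrite ?envelopeD ?envelopeZ ?envelopeM ?envelopeS; apply: pi_pw => n;
  rewrite /= subrr cstar_norm0.
Qed.

Lemma to_envelope_dense x (e : R) : 0 < e ->
  exists a, `|x - to_envelope a| <= e%:C.
Proof.
elim/quotP: x => u /(to_envelope_cvg u)[N uN].
by exists (u N); exact: uN.
Qed.

Fact envelope_complete (F : set_system envelope) :
  ProperFilter F -> cauchy F -> cvg F.
Proof.
move=> FF /cauchyP Fc.
pose d n : R := n.+1%:R^-1.
have d0 n : 0 < d n by rewrite invr_gt0.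
have dlim e : 0 < e -> exists N, forall n, (N <= n)%N -> d n < e.
  move=> e0; have [N _ dN] := near_infty_natSinv_lt (PosNum e0).
  by exists N.
have hx n : exists x : envelope, F (ball x (d n)%:C).
  by apply: Fc; rewrite ltcR.
pose x n := projT1 (cid (hx n)).
have xF n : F (ball (x n) (d n)%:C) by exact: projT2 (cid (hx n)).
have ha n : exists a : A, `|x n - to_envelope a| <= (d n)%:C.
  rewrite -[x n]reprK; have [N hN] := to_envelope_cvg (repr (x n)) (d0 n).
  by exists (repr (x n) N); exact: hN.
pose a n := projT1 (cid (ha n)).
have xa n : `|x n - to_envelope (a n)| <= (d n)%:C by exact: projT2 (cid (ha n)).
have xx m n : `|x m - x n| <= (d m + d n)%:C.
  have [y [ym yn]] := filter_ex (filterI (xF m) (xF n)).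
  rewrite -(subrK y (x m)) -addrA (le_trans (ler_normD _ _))// rmorphD/=.
  move: ym yn; rewrite -!ball_normE /ball_/= => ym yn.
  by rewrite lerD// ltW// distrC.
have aa m n : p (a m - a n) <= (d m + d n) + (d m + d n).
  rewrite -lecR -norm_to_envelope -to_envelopeB.
  have -> : to_envelope (a m) - to_envelope (a n) =
     (x m - x n) + ((to_envelope (a m) - x m) + (x n - to_envelope (a n))).
    by rewrite [RHS]addrCA !subrKA.
  rewrite (le_trans (ler_normD _ _))// rmorphD/= lerD//.
  rewrite (le_trans (ler_normD _ _))// rmorphD/= lerD//.
  by rewrite distrC.
have ac : cstar_cauchy a.
  move=> e e0; have [N dN] := dlim (e / 2 / 2) (divr_gt0 (divr_gt0 e0 (ltr0Sn _ _)) (ltr0Sn _ _)).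
  exists N => m n Nm Nn; rewrite (le_lt_trans (aa m n))//.
  have -> : e = (e / 2 / 2 + e / 2 / 2) + (e / 2 / 2 + e / 2 / 2) :> R.
    by rewrite -!splitr.
  by rewrite !ltrD// dN.
pose l := pi (CstarSeq ac).
apply/cvg_ex; exists l; apply/cvg_ballP => eps eps0.
have -> : eps = (re eps)%:C by apply: ge0_re; exact: ltW.
have e0 : 0 < re eps by rewrite -ltcR -ge0_re// ltW.
set e := re eps in e0 *.
have e40 := divr_gt0 (divr_gt0 e0 (ltr0Sn R 1)) (ltr0Sn R 1).
have [N1 dN] := dlim _ e40.
have [N2 lN] := to_envelope_cvg (CstarSeq ac) e40.
pose n := maxn N1 N2.
apply: filterS (xF n) => y; rewrite -!ball_normE /ball_/= => xy.
have dn : d n < e / 2 / 2 by apply: dN; rewrite leq_maxl.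
have h1 : `|l - to_envelope (a n)| <= (e / 2 / 2)%:C.
  by apply: lN; rewrite leq_maxr.
have h2 : `|to_envelope (a n) - x n| < (e / 2 / 2)%:C.
  by rewrite distrC; apply: le_lt_trans (xa n) _; rewrite ltcR.
have h3 : `|x n - y| < (e / 2 / 2 + e / 2 / 2)%:C.
  by apply: lt_trans xy _; rewrite ltcR (lt_trans dn)// ltrDl.
have -> : l - y = (l - to_envelope (a n)) + ((to_envelope (a n) - x n) + (x n - y)).
  by rewrite !subrKA.
have -> : e = e / 2 / 2 + (e / 2 / 2 + (e / 2 / 2 + e / 2 / 2)) :> R.
  by rewrite [RHS]addrA -!splitr.
apply: le_lt_trans (ler_normD _ _) _; rewrite rmorphD.
apply: ler_ltD h1 _.
apply: le_lt_trans (ler_normD _ _) _; rewrite rmorphD.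
exact: ltrD h2 h3.
Qed.

HB.instance Definition _ := Uniform_isComplete.Build envelope envelope_complete.

Fact envelope_amulA x y t : x ** (y ** t) = x ** y ** t.
Proof.
elim/quotP: x => u; elim/quotP: y => v; elim/quotP: t => w.
rewrite !envelopeM; apply: pi_pw => n; apply: cstar_norm_eq => B phi h.
by rewrite !(star_homM h) amulA.
Qed.
Fact envelope_amulDl x y t : (x + y) ** t = x ** t + y ** t.
Proof.
elim/quotP: x => u; elim/quotP: y => v; elim/quotP: t => w.
rewrite !(envelopeM, envelopeD).
apply: pi_pw => n; apply: cstar_norm_eq => B phi h.
by rewrite !(star_homM h, star_homD h) amulDl.
Qed.
Fact envelope_amulDr x y t : x ** (y + t) = x ** y + x ** t.
Proof.
elim/quotP: x => u; elim/quotP: y => v; elim/quotP: t => w.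
rewrite !(envelopeM, envelopeD).
apply: pi_pw => n; apply: cstar_norm_eq => B phi h.
by rewrite !(star_homM h, star_homD h) amulDr.
Qed.
Fact envelope_amulZl z x y : (z *: x) ** y = z *: (x ** y).
Proof.
elim/quotP: x => u; elim/quotP: y => v.
rewrite !(envelopeM, envelopeZ).
apply: pi_pw => n; apply: cstar_norm_eq => B phi h.
by rewrite !(star_homM h, star_homZ h) amulZl.
Qed.
Fact envelope_amulZr z x y : x ** (z *: y) = z *: (x ** y).
Proof.
elim/quotP: x => u; elim/quotP: y => v.
rewrite !(envelopeM, envelopeZ).
apply: pi_pw => n; apply: cstar_norm_eq => B phi h.
by rewrite !(star_homM h, star_homZ h) amulZr.
Qed.
Fact envelope_astarK x : astar (astar x) = x.
Proof.
elim/quotP: x => u; rewrite !envelopeS.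
apply: pi_pw => n; apply: cstar_norm_eq => B phi h.
by rewrite !(star_homS h) astarK.
Qed.
Fact envelope_astarD x y : astar (x + y) = astar x + astar y.
Proof.
elim/quotP: x => u; elim/quotP: y => v.
rewrite !(envelopeS, envelopeD).
apply: pi_pw => n; apply: cstar_norm_eq => B phi h.
by rewrite !(star_homS h, star_homD h) astarD.
Qed.
Fact envelope_astarZ z x : astar (z *: x) = z^* *: astar x.
Proof.
elim/quotP: x => u.
rewrite !(envelopeS, envelopeZ).
apply: pi_pw => n; apply: cstar_norm_eq => B phi h.
by rewrite !(star_homS h, star_homZ h) astarZ.
Qed.
Fact envelope_astarM x y : astar (x ** y) = astar y ** astar x.
Proof.
elim/quotP: x => u; elim/quotP: y => v.
rewrite !(envelopeS, envelopeM).
apply: pi_pw => n; apply: cstar_norm_eq => B phi h.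
by rewrite !(star_homS h, star_homM h) astarM.
Qed.
Fact envelope_normr_amul x y : `|x ** y| <= `|x| * `|y|.
Proof.
elim/quotP: x => u; elim/quotP: y => v; rewrite envelopeM.
rewrite !envelope_normE -rmorphM/= lecR.
apply: cseq_norm_le (cvgM (cseq_normP u) (cseq_normP v)) _ => n.
exact: cstar_normM.
Qed.
Fact envelope_normr_cstar x : `|astar x ** x| = `|x| ^+ 2.
Proof.
elim/quotP: x => u; rewrite envelopeS envelopeM.
rewrite !envelope_normE -rmorphXn/=; congr (_%:C).
rewrite expr2; apply: cseq_norm_eq (cvgM (cseq_normP u) (cseq_normP u)) _ => n.
apply/eqP; rewrite eq_le -[X in _ && (X <= _)]expr2 cstar_norm_cstar andbT.
apply: le_trans (cstar_normM _ _) _.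
by rewrite ler_wpM2r ?cstar_norm_ge0// cstar_normS_le.
Qed.

HB.instance Definition _ := isCStarAlgebra.Build R envelope
  envelope_amulA envelope_amulDl envelope_amulDr envelope_amulZl envelope_amulZr
  envelope_astarK envelope_astarD envelope_astarZ envelope_astarM
  envelope_normr_amul envelope_normr_cstar.

End Envelope.
Arguments envelope {R} A.

Definition cstar_isomorphic (R : realType) (A B : cstarAlgType R) : Prop :=
  exists2 T : A -> B, is_star_hom T & bijective T.

(* Main.v *)
Require Import Defs.
From HB Require Import structures.
From mathcomp Require Import all_boot all_order all_algebra complex finmap.
From mathcomp Require Import all_classical all_reals all_analysis.

Set Implicit Arguments.
Unset Strict Implicit.
Unset Printing Implicit Defensive.

Import Order.TTheory GRing.Theory Num.Theory.
Import numFieldNormedType.Exports.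

Local Open Scope classical_set_scope.
Local Open Scope complex_scope.
Local Open Scope ring_scope.

(** Choosing the section [k] puts coordinates on [E]: every [e] is uniquely
    [n k(x)] with [x = j e] and [n = e k(x)^-1] in the fibre over [rng x]
    ([fibre_part], [fibre_partK], [fibre_sec_inj]). The map [Phi] rewrites a
    function on [E] in these coordinates, so it is a bijection, and a finite sum
    over [E] becomes a double sum over [x] and [n] ([fsum_extension]). Applied to
    absolute values, this says that [Phi] is isometric.

    The factor system is what the operations of [E] become in coordinates:
    [(a k(x)) (b k(y)) = a L_x(b) sigma(x,y) k(xy)] ([gmul_fibre_sec]). For the
    product, the convolution over the pairs with [e e' = w] is written as the sum
    of [f e * g (e^-1 w)] over the [e] with the range of [w]
    ([groupoid_mulE]). Summed in coordinates, the terms with [j e = x] are, by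
    [gmul_ginv_fibre_sec], the summand of the crossed product for the
    factorization [z = x (x^-1 z)] ([cp_term_Phi]). The involution needs only the
    coordinates of [(n k(x))^-1] ([ginv_fibre_sec]); the factor
    [tau(x,x^-1)^-1] appears because [k(x^-1)] need not be [k(x)^-1].

    For the C*-algebras, the enveloping construction is functorial for contractive
    *-homomorphisms, since composition with such a map pulls contractive
    representations back to contractive representations
    ([cstar_norm_contract]). Both [Phi] and its inverse are contractive, so they
    induce mutually inverse *-homomorphisms ([envelope_isomorphic]). *)

(** * Finitely supported sums *)

(** A finite sum may be grouped by the fibres of any map. Only the support of [F]
    is finite: both sides are reduced to the support of [F] and its image under
    [h], where the order of summation can be exchanged. *)
Lemma fsum_fibration (V : nmodType) (I J : choiceType) (h : I -> J)
    (P : set J) (F : I -> V) : finite_set [set i | F i != 0] ->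
  \sum_(i \in h @^-1` P) F i =
  \sum_(y \in P) \sum_(i \in h @^-1` [set y]) F i.
Proof.
move=> finF; set S := [set i | F i != 0] in finF.
have inS i : (i \in fset_set S) = (F i != 0) by rewrite in_fset_set// mem_setE.
have sumS (Q : set I) :
    \sum_(i \in Q) F i = \sum_(i <- fset_set S) if i \in Q then F i else 0.
  rewrite fsbig_mkcond; apply: fsbigTE => i.
  by rewrite inS negbK /patch => /eqP ->; case: ifP.
have inhS y : (y \in fset_set (h @` S)) = (y \in h @` S).
  exact/in_fset_set/finite_image.
rewrite sumS fsbig_mkcond (@fsbigTE _ _ _ _ (fset_set (h @` S))); last first.
  move=> y; rewrite inhS => /negP yS; rewrite /patch; case: ifP => // _.
  apply: fsbig1 => i /= hi; apply: contrapT => /eqP Fi; apply: yS.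
  by rewrite inE; exists i.
under [RHS]eq_bigr do rewrite /patch sumS big_mkcond /= .
rewrite [RHS](eq_bigr (fun y => \sum_(i <- fset_set S)
    if (y \in P) && (h i == y) then F i else 0)); last first.
  move=> y _; case: ifP => _; last by rewrite big1.
  apply: eq_bigr => i _; congr (if _ then _ else _).
  by apply/idP/eqP; rewrite inE.
rewrite exchange_big/=; apply: eq_big_seq => i iS.
have hiS : h i \in fset_set (h @` S).
  by rewrite inhS inE; exists i => //; rewrite /S/= -inS.
rewrite (bigD1_seq (h i))//= eqxx andbT big1 ?addr0//.
by move=> y; rewrite eq_sym => /negPf ->; rewrite andbF.
Qed.

(** Finiteness of the support matters: a sum with infinite support is [0] by
    convention, although its terms may have finite support at each [i]. *)
Lemma fsprod_fsum (K : numFieldType) (I : choiceType)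
    (V : I -> normedModType K) (T : choiceType) (A : set T)
    (F : T -> fsprod V) (i : I) : finite_set [set t | F t != 0] ->
  (\sum_(t \in A) F t) i = \sum_(t \in A) F t i.
Proof.
move=> finF; have inS t : (t \in fset_set [set t | F t != 0]) = (F t != 0).
  by rewrite in_fset_set// mem_setE.
rewrite fsbig_mkcond [RHS]fsbig_mkcond.
rewrite !(@fsbigTE _ _ _ _ (fset_set [set t | F t != 0])).
- rewrite (big_morph (fun h : fsprod V => h i) (id1 := 0) (op1 := +%R))//.
  by apply: eq_bigr => t _; rewrite /patch; case: ifP.
- by move=> t; rewrite inS negbK /patch => /eqP ->; case: ifP.
- by move=> t; rewrite inS negbK /patch => /eqP ->; case: ifP.
Qed.

(** * Convolution over a groupoid and over a group *)

Section Groupoid.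
Context {U : choiceType} {G : groupoidType U}.

Lemma gmulVKl (x y : G) : rng x = rng y -> gmul x (gmul (ginv x) y) = y.
Proof.
by move=> xy; have := @gmulKl _ _ (ginv x) y; rewrite ginvK src_ginv => ->.
Qed.

Lemma gmulVKr (x y : G) : src x = src y -> gmul (gmul x (ginv y)) y = x.
Proof.
by move=> xy; have := @gmulKr _ _ x (ginv y); rewrite ginvK rng_ginv => ->.
Qed.

(** The first factor determines the second, so convolution is a sum over single
    elements, to which [fsum_extension] can be applied. *)
Lemma groupoid_mulE (R : realType) (f g : groupoid_algebra R G) (w : G) :
  (f ** g) w = \sum_(x \in [set x | rng x = rng w]) f x * g (gmul (ginv x) w).
Proof.
rewrite /=; pose h (x : G) := (x, gmul (ginv x) w).
rewrite (reindex_fsbig h [set x | rng x = rng w])//; split.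
- move=> x /= xw; rewrite rng_gmul ?src_ginv// rng_ginv; split => //.
  exact: gmulVKl.
- by move=> x y _ _ [].
- by move=> [x y] /= [xy xyw]; exists x; rewrite /h -xyw /= ?rng_gmul// gmulKl.
Qed.

End Groupoid.

Section GroupAlgebraFacts.
Context {R : realType} {H : groupType}.
Implicit Types f g : group_algebra R H.

Lemma group_mulE f g n :
  (f ** g) n = \sum_(m \in [set: H]) f m * g (m^-1 * n)%g.
Proof.
rewrite /=; pose h (m : H) := (m, (m^-1 * n)%g).
rewrite (reindex_fsbig h [set: H])//; split.
- by move=> m _ /=; rewrite mulVKg.
- by move=> m l _ _ [].
- by move=> [m l] /= mln; exists m; rewrite // /h -mln mulKg.
Qed.

Lemma group_mul_delta f m n : (f ** delta R m) n = f (n * m^-1)%g.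
Proof.
rewrite group_mulE -(@fsbig_widen _ _ _ _ [set (n * m^-1)%g])//.
  by rewrite fsbig_set1 /= invgM invgK -mulgA mulVg mulg1 eqxx mulr1.
move=> l [_ /= nl]; case: eqP => [lm|]; last by rewrite mulr0.
by case: nl; rewrite -lm invgM invgK mulVKg.
Qed.

Lemma group_delta_mul f m n : (delta R m ** f) n = f (m^-1 * n)%g.
Proof.
rewrite group_mulE -(@fsbig_widen _ _ _ _ [set m])//.
  by rewrite fsbig_set1 /= eqxx mul1r.
by move=> l [_ /= /eqP/negPf ->]; rewrite mul0r.
Qed.

End GroupAlgebraFacts.

(** * Coordinates on an extension *)

Section Coordinates.
Context {U : choiceType} {E G : groupoidType U}.
Context {j : extension E G} (k : normalized_section j).
Implicit Types x y z : G.

Lemma src_fibre_rng_sec x (n : fibre j (rng x)) : src (val n) = rng (k x).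
Proof. by rewrite src_fibre rng_sec. Qed.

Lemma rng_fibre_sec x (n : fibre j (rng x)) : rng (gmul (val n) (k x)) = rng x.
Proof. by rewrite rng_gmul ?rng_fibre// src_fibre_rng_sec. Qed.

Lemma ext_fibre_sec x (n : fibre j (rng x)) : j (gmul (val n) (k x)) = x.
Proof.
by rewrite ext_gmul ?src_fibre_rng_sec// fibreP sec_cancel gmul1l.
Qed.

Lemma fibre_sec_inj x : injective (fun n : fibre j (rng x) => gmul (val n) (k x)).
Proof.
move=> m n mn; apply: val_inj.
by rewrite -(gmulKr (src_fibre_rng_sec m)) mn gmulKr ?src_fibre_rng_sec.
Qed.

Fact fibre_part_subproof (e : E) : j (gmul e (ginv (k (j e)))) == gid (rng (j e)).
Proof.
rewrite ext_gmul; last by rewrite rng_ginv src_sec ext_src.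
by rewrite ext_ginv sec_cancel gmulV.
Qed.

Definition fibre_part (e : E) : fibre j (rng (j e)) :=
  exist _ (gmul e (ginv (k (j e)))) (fibre_part_subproof e).

Lemma fibre_partK (e : E) : gmul (val (fibre_part e)) (k (j e)) = e.
Proof. by rewrite /= gmulVKr// src_sec ext_src. Qed.

(** For fixed [x], the map sending [n] to [n k(x)] is a bijection from the fibre
    over [rng x] onto the preimage of [x] under [j]. *)
Lemma fsum_extension (V : nmodType) (P : set G) (F : E -> V) :
  finite_set [set e | F e != 0] ->
  \sum_(e \in j @^-1` P) F e =
  \sum_(x \in P) \sum_(n \in [set: fibre j (rng x)]) F (gmul (val n) (k x)).
Proof.
move=> finF; rewrite fsum_fibration//; apply: eq_fsbigr => x _.
apply: reindex_fsbig; split.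
- by move=> n _ /=; exact: ext_fibre_sec.
- by move=> m n _ _ /fibre_sec_inj.
- by move=> e /= <-; exists (fibre_part e) => //; exact: fibre_partK.
Qed.

(** Insert [k(x)^-1 k(x)] after [b] in [a k(x) b k(y)], then replace
    [k(x) b k(x)^-1] by [L_x(b)] and [k(x) k(y)] by [sigma(x,y) k(xy)]. *)
Lemma gmul_fibre_sec x y (xy : src x = rng y) (a : fibre j (rng x))
    (b : fibre j (src x)) :
  gmul (gmul (val a) (k x)) (gmul (val b) (k y)) =
  gmul (val (a * facL k x b * sigma k xy)%g) (k (gmul x y)).
Proof.
have ak : src (val a) = rng (k x) by exact: src_fibre_rng_sec.
have kb : src (k x) = rng (val b) by rewrite src_sec rng_fibre.
have bk : src (val b) = rng (k y) by rewrite src_fibre rng_sec.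
have kk : src (k x) = rng (k y) by rewrite src_sec rng_sec.
have sk : src (val (sigma k xy)) = rng (k (gmul x y)).
  by rewrite src_fibre rng_sec rng_gmul.
have fibre_comp (u : U) (m n : fibre j u) : src (val m) = rng (val n).
  by rewrite src_fibre rng_fibre.
rewrite !val_fibreM -[RHS]gmulA//; last first.
  by rewrite src_gmul.
rewrite -sigmaE -[RHS]gmulA//; last first.
  by rewrite src_fibre rng_gmul// rng_sec.
rewrite -[LHS]gmulA//; last by rewrite rng_gmul.
congr gmul; rewrite [RHS]gmulA//; last by rewrite src_fibre rng_sec.
rewrite /= gmulVKr; last by rewrite src_gmul// src_fibre src_sec.
by rewrite gmulA.
Qed.

(** [gmul_fibre_sec] solved for the second factor: with [a] and the product
    [n k(xy)] given, [L_x(b)] must be [a^-1 n sigma(x,y)^-1]. *)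
Lemma gmul_ginv_fibre_sec x y (xy : src x = rng y) (a n : fibre j (rng x)) :
  gmul (ginv (gmul (val a) (k x))) (gmul (val n) (k (gmul x y))) =
  gmul (val (facLinv k x (a^-1 * (n * (sigma k xy)^-1)))%g) (k y).
Proof.
set b := facLinv _ _ _.
have -> : n = (a * facL k x b * sigma k xy)%g.
  by rewrite facLinvK mulVKg mulgVK.
rewrite -gmul_fibre_sec gmulKl// src_gmul ?src_fibre_rng_sec// src_sec.
by rewrite rng_gmul ?rng_fibre// src_fibre rng_sec.
Qed.

(** By [gmul_fibre_sec], [b k(x^-1)] is a right inverse of [n k(x)] as soon as
    [n L_x(b) sigma(x,x^-1) = 1], because [k] maps the unit [x x^-1] to a unit. *)
Lemma ginv_fibre_sec x (n : fibre j (rng x)) :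
  ginv (gmul (val n) (k x)) =
  gmul (val (facLinv k x (sigma k (esym (rng_ginv x)) * n)^-1%g)) (k (ginv x)).
Proof.
set b := facLinv _ _ _; apply/esym/gmul_eq1.
  rewrite src_gmul ?src_fibre_rng_sec// src_sec.
  by rewrite rng_gmul ?rng_fibre// src_fibre rng_sec rng_ginv.
rewrite (gmul_fibre_sec (esym (rng_ginv x))) facLinvK rng_fibre_sec.
rewrite gmulV sec_gid invgM mulVKg mulVg val_fibre1.
by have := gmul1l (gid (rng x) : E); rewrite rng_gid.
Qed.

End Coordinates.

(** * The map Phi *)

Section Isomorphism.
Context (R : realType) {U : choiceType} {E G : groupoidType U}.
Context {j : extension E G} (k : normalized_section j).
Implicit Types (f g : groupoid_algebra R E) (F : crossed_product R k).

Lemma norm_Phi f : `|Phi R k f| = `|f|.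
Proof.
rewrite !fsprod_norm -[[set: E]]/(j @^-1` [set: G]) (fsum_extension k)//.
by apply: sub_finite_set (fsprod_fin f) => e /=; rewrite normr_eq0.
Qed.

Lemma transport_Phi f x v (e : rng x = v) (n : fibre j v) :
  transport e (Phi R k f x) n = f (gmul (val n) (k x)).
Proof. by case: v / e n. Qed.

Lemma transport_val u v (e : u = v) (h : group_algebra R (fibre j u))
  (m : fibre j u) (n : fibre j v) : val m = val n -> transport e h n = h m.
Proof. by case: v / e n => n /val_inj ->. Qed.

(** The right-hand side depends on the factorization only through its first
    element, which lets the sum over factorizations become one over elements of
    [G] in [PhiM]. *)
Lemma cp_term_Phi f g z (p : factorizations z) (n : fibre j (rng z)) :
  cp_term (Phi R k f) (Phi R k g) p n =
  \sum_(a \in [set: fibre j (rng (fac1 p))])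
    f (gmul (val a) (k (fac1 p))) *
    g (gmul (ginv (gmul (val a) (k (fac1 p)))) (gmul (val n) (k z))).
Proof.
(* [m] is [n] seen in the fibre over the propositionally equal unit. *)
have [m mn] : exists m : fibre j (rng (fac1 p)), val m = val n.
  by rewrite fac_rng; exists n.
rewrite /cp_term (transport_val _ _ mn) group_mul_delta group_mulE.
apply: eq_fsbigr => a _; congr (_ * _).
have -> : k z = k (gmul (fac1 p) (fac2 p)) by rewrite fac_mul.
by rewrite /= transport_Phi -mn (gmul_ginv_fibre_sec k (fac_src p)).
Qed.

Lemma cp_term_fin (F1 F2 : crossed_product R k) z :
  finite_set [set p : factorizations z | cp_term F1 F2 p != 0].
Proof.
have fin := finite_setX (fsprod_fin F1) (fsprod_fin F2).
apply: sub_finite_set (finite_preimage (f := val) _ fin); last first.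
  by move=> p q _ _; exact: val_inj.
move=> p /= p0; split => /=; apply: contraNN p0 => /eqP h;
  rewrite /cp_term /fac1 /fac2 h ?transport0 ?facM0.
  by rewrite !ga_mul0l transport0.
by rewrite ga_mul0r ga_mul0l transport0.
Qed.

Lemma PhiM : {morph Phi R k : f g / f ** g}.
Proof.
move=> f g; apply: fsprodP => z; apply: fsprodP => n.
rewrite [LHS]groupoid_mulE rng_fibre_sec.
rewrite [RHS](fsprod_fsum _ _ (cp_term_fin _ _ _)).
under [RHS]eq_fsbigr do rewrite cp_term_Phi.
(* When [rng x = rng z], [S x] is the contribution to [(f ** g) (n k(z))] of the
   first factors [e] with [j e = x]. *)
pose S x := \sum_(a \in [set: fibre j (rng x)]) f (gmul (val a) (k x)) *
  g (gmul (ginv (gmul (val a) (k x))) (gmul (val n) (k z))).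
rewrite -[RHS](reindex_fsbig (@fac1 _ _ z) _ [set x | rng x = rng z] S).
  rewrite -(@fsum_extension _ _ _ _ k _ [set x | rng x = rng z]
    (fun e => f e * g (gmul (ginv e) (gmul (val n) (k z))))).
    by apply: eq_fsbigl; apply/funext => e /=; rewrite ext_rng.
  apply: sub_finite_set (fsprod_fin f) => e /=.
  by apply: contraNN => /eqP ->; rewrite mul0r.
split.
- by move=> p _ /=; exact: fac_rng.
- move=> p q _ _ pq; apply: val_inj.
  have e2 (r : factorizations z) : fac2 r = gmul (ginv (fac1 r)) z.
    by have := gmulKl (fac_src r); rewrite fac_mul.
  have := e2 p; rewrite pq -e2; move: pq; rewrite /fac1 /fac2.
  by case: (val p) (val q) => [? ?] [? ?] /= -> ->.
- move=> x /= xz.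
  have h : (src x == rng (gmul (ginv x) z)) && (gmul x (gmul (ginv x) z) == z).
    by rewrite rng_gmul ?src_ginv// rng_ginv eqxx gmulVKl/=.
  by exists (exist _ (x, gmul (ginv x) z) h).
Qed.

Lemma PhiS : {morph Phi R k : f / astar f}.
Proof.
move=> f; apply: fsprodP => x; apply: fsprodP => n.
rewrite -[RHS]/(cp_star_fun (Phi R k f) x n) /cp_star_fun /tau_inv.
by rewrite group_delta_mul /= transport_Phi ginv_fibre_sec invgK.
Qed.

Lemma Phi_star_hom : is_star_hom (Phi R k).
Proof.
split; [| |exact: PhiM|exact: PhiS].
- by move=> f g; apply: fsprodP => x; apply: fsprodP.
- by move=> t f; apply: fsprodP => x; apply: fsprodP.
Qed.

Definition Phi_inv_fun F (e : E) : (R[i])^o := F (j e) (fibre_part k e).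

(** [j (n k(x))] and [x] are equal only propositionally, so the two values of [F]
    lie in different types; [Feq] compares them at equal points. *)
Lemma Phi_inv_fun_sec F x (n : fibre j (rng x)) :
  Phi_inv_fun F (gmul (val n) (k x)) = F x n.
Proof.
have Feq y (m : fibre j (rng y)) : x = y -> val n = val m -> F x n = F y m.
  by move=> xy; case: y / xy m => m /val_inj ->.
apply/esym/Feq; first by rewrite ext_fibre_sec.
by rewrite /= ext_fibre_sec gmulKr// (src_fibre_rng_sec k).
Qed.

Fact Phi_inv_fin F : finite_set [set e | Phi_inv_fun F e != 0].
Proof.
have fin : finite_set (\bigcup_(x in [set x | F x != 0])
    ((fun n : fibre j (rng x) => gmul (val n) (k x)) @` [set n | F x n != 0])).
  apply: bigcup_finite => [|x _]; first exact: fsprod_fin.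
  exact/finite_image/fsprod_fin.
apply: sub_finite_set fin => e /= Fe; exists (j e) => /=.
  by apply: contraNN Fe => /eqP Fe; rewrite /Phi_inv_fun Fe.
by exists (fibre_part k e) => //; exact: fibre_partK.
Qed.

Definition Phi_inv F : groupoid_algebra R E := FsProd _ (Phi_inv_fin F).

Lemma PhiK : cancel (Phi R k) Phi_inv.
Proof.
move=> f; apply: fsprodP => e.
by rewrite /= /Phi_inv_fun /= gmulVKr// src_sec ext_src.
Qed.

Lemma Phi_invK : cancel Phi_inv (Phi R k).
Proof.
by move=> F; apply: fsprodP => x; apply: fsprodP => n; exact: Phi_inv_fun_sec.
Qed.

End Isomorphism.

(** * Functoriality of the enveloping C*-algebra *)

Section EnvelopeFunctor.
Context {R : realType}.

Lemma envelope_ind (A : normedStarType R) (P : envelope A -> Prop) :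
  (forall u, P (\pi_(envelope A)%qT u)) -> forall x, P x.
Proof. by move=> h x; rewrite -[x]reprK. Qed.

Section Map.
Context {A B : normedStarType R} (phi : A -> B).
Context (phi_hom : is_star_hom phi) (phi_le : forall a, `|phi a| <= `|a|).

(** A contractive representation of [B] composed with [phi] is one of [A], so the
    supremum that defines [cstar_norm a] includes all the norms for [phi a]. *)
Lemma cstar_norm_contract a : cstar_norm (phi a) <= cstar_norm a.
Proof.
apply: cstar_norm_le => [|C rho rho_hom rho_le]; first exact: cstar_norm_ge0.
apply: (@le_cstar_norm _ _ a C (rho \o phi)).
  by split=> [x y|t x|x y|x] /=;
    rewrite ?(star_homD phi_hom, star_homZ phi_hom, star_homM phi_hom,
      star_homS phi_hom) ?(star_homD rho_hom, star_homZ rho_hom,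
      star_homM rho_hom, star_homS rho_hom).
by move=> x; exact: le_trans (rho_le _) (phi_le _).
Qed.

Fact cauchy_map_subproof (u : @cstar_seq R A) : cstar_cauchy (phi \o u).
Proof.
move=> e /(cseqP u)[N uN]; exists N => m n Nm Nn /=.
by rewrite -(star_homB phi_hom) (le_lt_trans (cstar_norm_contract _))// uN.
Qed.

Definition cauchy_map u : @cstar_seq R B := CstarSeq (@cauchy_map_subproof u).

Definition envelope_map (x : envelope A) : envelope B :=
  \pi_(envelope B)%qT (cauchy_map (repr x)).

(** The map on classes does not depend on the representative, since [phi] sends
    null sequences to null sequences. *)
Lemma envelope_mapE u :
  envelope_map (\pi_(envelope A)%qT u) = \pi_(envelope B)%qT (cauchy_map u).
Proof.
apply/Defs.piP/cseq_norm_le0; rewrite -(repr_pi u).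
apply: cseq_norm_le (@cseq_cvg _ _ _) _ => n /=.
by rewrite -(star_homB phi_hom) cstar_norm_contract.
Qed.

Lemma envelope_map_hom : is_star_hom envelope_map.
Proof.
have pw (u v : @cstar_seq R B) : u =1 v ->
    \pi_(envelope B)%qT u = \pi_(envelope B)%qT v.
  by move=> uv; apply: pi_pw => n; rewrite uv subrr cstar_norm0.
split=> [|t||]; elim/envelope_ind => u.
- elim/envelope_ind => v; rewrite envelopeD !envelope_mapE envelopeD.
  by apply: pw => n /=; rewrite (star_homD phi_hom).
- rewrite envelopeZ !envelope_mapE envelopeZ.
  by apply: pw => n /=; rewrite (star_homZ phi_hom).
- elim/envelope_ind => v; rewrite envelopeM !envelope_mapE envelopeM.
  by apply: pw => n /=; rewrite (star_homM phi_hom).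
- rewrite envelopeS !envelope_mapE envelopeS.
  by apply: pw => n /=; rewrite (star_homS phi_hom).
Qed.

End Map.

Lemma envelope_mapK (A B : normedStarType R) (phi : A -> B) (psi : B -> A)
    (phi_hom : is_star_hom phi) (phi_le : forall a, `|phi a| <= `|a|)
    (psi_hom : is_star_hom psi) (psi_le : forall b, `|psi b| <= `|b|) :
  cancel phi psi ->
  cancel (envelope_map phi_hom phi_le) (envelope_map psi_hom psi_le).
Proof.
move=> phiK; elim/envelope_ind => u; rewrite !envelope_mapE.
by apply: pi_pw => n; rewrite /= phiK subrr cstar_norm0.
Qed.

Lemma star_hom_inverse (A B : normedStarType R) (phi : A -> B) (psi : B -> A) :
  is_star_hom phi -> cancel phi psi -> cancel psi phi -> is_star_hom psi.
Proof.
move=> h phiK psiK; have inj := can_inj phiK.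
by split=> [x y|t x|x y|x]; apply: inj;
  rewrite (star_homD h, star_homZ h, star_homM h, star_homS h) !psiK.
Qed.

Lemma envelope_isomorphic (A B : normedStarType R) (phi : A -> B) :
  is_star_hom phi -> (forall a, `|phi a| = `|a|) -> bijective phi ->
  cstar_isomorphic (envelope A) (envelope B).
Proof.
move=> phi_hom phi_norm [psi phiK psiK].
have psi_hom := star_hom_inverse phi_hom phiK psiK.
have phi_le a : `|phi a| <= `|a| by rewrite phi_norm.
have psi_le b : `|psi b| <= `|b| by rewrite -phi_norm psiK.
exists (envelope_map phi_hom phi_le); first exact: envelope_map_hom.
by exists (envelope_map psi_hom psi_le); exact: envelope_mapK.
Qed.

End EnvelopeFunctor.

Theorem proposition4p11 (R : realType) (U : choiceType) (E G : groupoidType U)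
    (j : extension E G) (k : normalized_section j) :
  [/\ is_star_hom (Phi R k),
      (forall f : groupoid_algebra R E, `|Phi R k f| = `|f|) &
      cstar_isomorphic (envelope (groupoid_algebra R E))
                       (envelope (crossed_product R k))].
Proof.
have Phi_bij : bijective (Phi R k).
  by exists (Phi_inv (k := k)); [exact: PhiK|exact: Phi_invK].
split; [exact: Phi_star_hom|exact: norm_Phi|].
exact: envelope_isomorphic (Phi_star_hom R k) (norm_Phi k) Phi_bij.
Qed.
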